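(* Let $0<q<1$. For all $l,n\in\mathbb{Z}_+$ with $0\leq n\leq l$, all $m,p\in\mathbb{Z}_+$ and all $\sigma,\tau\in\mathbb{R}$, $$ \begin{aligned} &P^{(n,n)}_{l-n}(-q^m;q^{2\tau},1;q)\, P^{(n,n)}_{l-n}(-q^{m+p};q^{2\sigma},1;q) \\ &= \frac1C \int_{\mathbb{R}} p^{(0,0)}_l(x;q^\tau,q^\sigma\mid q)\, l_m^{(p)}(x;q^\tau,q^\sigma\mid q)\, l_{m+n}^{(p)}(x;q^\tau,q^\sigma\mid q)\, dm^{(p)}(x;q^\tau,q^\sigma\mid q) , \end{aligned} $$ with $$ C = D^{n,l}(\tau,\sigma)\, (q,q^{1+p},-q^{1-2\tau},-q^{1+p-2\sigma};q)_{m+n}, $$ $$ D^{n,l}(\tau,\sigma) = (-q^{2\sigma-l},-q^{2\tau-l};q)_{l-n}\, \frac{(q^{l-n+1};q)_n}{(q;q)_n}\, (q^{n+1};q)_l\; q^{\frac12 (l-n)(l-n-2\sigma-2\tau)} . $$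
   Context: $\mathbb{Z}_+=\{0,1,2,\ldots\}$ and $0<q<1$ is fixed. Put $(a;q)_k=\prod_{i=0}^{k-1}(1-aq^i)$ (empty product $=1$) and $(a_1,\ldots,a_j;q)_k=\prod_{i=1}^j(a_i;q)_k$. Basic hypergeometric series: $${}_{r+1}\varphi_r\left({a_1,\ldots,a_{r+1}\atop b_1,\ldots,b_r};q,z\right)=\sum_{k=0}^\infty\frac{(a_1,\ldots,a_{r+1};q)_k}{(q,b_1,\ldots,b_r;q)_k}z^k .$$ Askey-Wilson polynomials (polynomials of degree $n$ in $x=\cos\theta$, extended to all $x\in\mathbb{C}$): $$p_n(\cos\theta;a,b,c,d\mid q)=a^{-n}(ab,ac,ad;q)_n\;{}_4\varphi_3\left({q^{-n},abcdq^{n-1},ae^{i\theta},ae^{-i\theta}\atop ab,\ ac,\ ad};q,q\right).$$ The $q$-Jacobi case (for $\alpha=\beta=0$: the $q$-Legendre polynomials): $$p_n^{(\alpha,\beta)}(x;s,t\mid q)=p_n\bigl(x;q^{1/2+\alpha}s/t,\,q^{1/2}t/s,\,-q^{1/2}/(st),\,-stq^{1/2+\beta}\mid q\bigr).$$ The $q$-Laguerre case: $$l_n^{(\alpha)}(x;s,t\mid q)=p_n\bigl(x;q^{1/2+\alpha}s/t,\,q^{1/2}t/s,\,-q^{1/2}/(st),\,0\mid q\bigr).$$ Big $q$-Jacobi polynomials: $$P_n^{(\alpha,\beta)}(x;c,d;q)={}_3\varphi_2\left({q^{-n},\,q^{n+\alpha+\beta+1},\,q^{1+\alpha}x/c\atop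 q^{\alpha+1},\,-q^{1+\alpha}d/c};q,q\right).$$ For $\alpha\in\mathbb{Z}_+$ and $s,t>0$, $dm^{(\alpha)}(\cdot;s,t\mid q)$ denotes the normalised (total mass $1$) orthogonality measure on $\mathbb{R}$ of the $q$-Laguerre polynomials, i.e. the unique Borel probability measure on $\mathbb{R}$ with $$\int_{\mathbb{R}} l_i^{(\alpha)}(x;s,t\mid q)\,l_j^{(\alpha)}(x;s,t\mid q)\,dm^{(\alpha)}(x;s,t\mid q)=\delta_{i,j}\,(q,q^{1+\alpha},-qs^{-2},-q^{1+\alpha}t^{-2};q)_j,\qquad i,j\in\mathbb{Z}_+ .$$ (It has compact support: an absolutely continuous part on $[-1,1]$ plus finitely many, possibly zero, point masses off $[-1,1]$.) *)

(* Defs.v *)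
From HB Require Import structures.
From mathcomp Require Import all_boot all_order all_algebra.
From mathcomp Require Import complex ring.
From mathcomp Require Import all_classical all_reals all_analysis.

Set Implicit Arguments.
Unset Strict Implicit.
Unset Printing Implicit Defensive.

Import Order.TTheory GRing.Theory Num.Theory.
Import numFieldNormedType.Exports.

Local Open Scope classical_set_scope.
Local Open Scope complex_scope.
Local Open Scope ring_scope.

Section BasicHypergeometric.
Variable K : numFieldType.
Implicit Types (a q z : K) (s bs : seq K).

Definition qpoch a q k : K := \prod_(i < k) (1 - a * q ^+ i).

Definition qpochs s q k : K := \prod_(a <- s) qpoch a q k.

Definition qhyp_term s bs q z k : K :=
  qpochs s q k / qpochs (q :: bs) q k * z ^+ k.

Definition qhyp s bs q z : K := limn (series (qhyp_term s bs q z)).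

Lemma qpoch_terminating q n k : q != 0 -> (n < k)%N -> qpoch (q ^- n) q k = 0.
Proof.
move=> q0 nk; rewrite /qpoch (bigD1 (Ordinal nk)) //= mulVf ?subrr ?mul0r //.
by rewrite expf_neq0.
Qed.

Lemma qhyp_terminating s bs q z n : q != 0 ->
  qhyp (q ^- n :: s) bs q z =
  \sum_(k < n.+1) qhyp_term (q ^- n :: s) bs q z k.
Proof.
move=> q0; rewrite /qhyp; apply: lim_near_cst => //.
near=> N; have nN : (n.+1 <= N)%N by near: N; exact: nbhs_infty_ge.
rewrite /series /= (big_cat_nat (leq0n _) nN) /= big_mkord [X in _ + X]big_nat.
rewrite [X in _ + X]big1 ?addr0// => k /andP[nk _].
by rewrite /qhyp_term {1}/qpochs big_cons qpoch_terminating// !mul0r.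
Unshelve. all: by end_near. Qed.

End BasicHypergeometric.

Section AskeyWilson.
Variable R : realType.

(* For x = cos theta, [w] plays the role of e^(i theta).  It is one of the two
   solutions of w + 1/w = 2x; the other one, 1/w, gives the same value
   (see [askey_wilsonE]). *)
Definition askey_wilson (q : R[i]) (n : nat) (x a b c d : R[i]) : R[i] :=
  let w := x + sqrtC (x ^+ 2 - 1) in
  a ^- n * qpochs [:: a * b; a * c; a * d] q n *
  qhyp [:: q ^- n; a * b * c * d * q ^ (n%:Z - 1); a * w; a / w]
       [:: a * b; a * c; a * d] q q.

Definition askey_wilson_real (q : R) (n : nat) (x a b c d : R) : R :=
  complex.Re (askey_wilson q%:C n x%:C a%:C b%:C c%:C d%:C).

Lemma qpoch_pair (q a w : R[i]) k : w != 0 ->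
  qpoch (a * w) q k * qpoch (a / w) q k =
  \prod_(i < k) (1 - a * q ^+ i * (w + w^-1) + a ^+ 2 * q ^+ i ^+ 2).
Proof.
move=> w0; rewrite /qpoch -big_split /=; apply: eq_bigr => i _.
by field.
Qed.

Lemma qhyp_pair (q a e w z : R[i]) bs n : q != 0 -> w != 0 -> z != 0 ->
  w + w^-1 = z + z^-1 ->
  qhyp [:: q ^- n; e; a * w; a / w] bs q q =
  qhyp [:: q ^- n; e; a * z; a / z] bs q q.
Proof.
move=> q0 w0 z0 wz; rewrite !qhyp_terminating//; apply: eq_bigr => k _.
by rewrite /qhyp_term /qpochs !big_cons !big_nil !mulr1 !qpoch_pair// wz.
Qed.

Lemma joukowski_root (x : R[i]) (w := x + sqrtC (x ^+ 2 - 1)) :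
  w != 0 /\ w + w^-1 = x *+ 2.
Proof.
have ww : w * (x - sqrtC (x ^+ 2 - 1)) = 1.
  by rewrite /w mulrC -subr_sqr sqrtCK opprB addrC subrK.
have w0 : w != 0.
  by apply/eqP => w0; move: ww; rewrite w0 mul0r => /esym/eqP; rewrite oner_eq0.
have -> : w^-1 = x - sqrtC (x ^+ 2 - 1).
  by apply: (mulfI w0); rewrite ww mulfV.
by split=> //; rewrite /w addrACA subrr addr0 mulr2n.
Qed.

Lemma askey_wilsonE (q : R[i]) n (z a b c d : R[i]) : q != 0 -> z != 0 ->
  askey_wilson q n ((z + z^-1) / 2) a b c d =
  a ^- n * qpochs [:: a * b; a * c; a * d] q n *
  qhyp [:: q ^- n; a * b * c * d * q ^ (n%:Z - 1); a * z; a / z]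
       [:: a * b; a * c; a * d] q q.
Proof.
move=> q0 z0; rewrite /askey_wilson; congr (_ * _).
have [w0 wE] := joukowski_root ((z + z^-1) / 2).
by apply: qhyp_pair => //; rewrite wE -[LHS]mulr_natr divfK // pnatr_eq0.
Qed.

Lemma askey_wilson_morph (f : {rmorphism R -> R[i]}) (q : R) n
    (x a b c d : R) : q != 0 ->
  exists r, askey_wilson (f q) n (f x) (f a) (f b) (f c) (f d) = f r.
Proof.
move=> q0; have fq0 : f q != 0 by rewrite fmorph_eq0.
have pochsR s k : qpochs [seq f e | e <- s] (f q) k = f (qpochs s q k).
  rewrite /qpochs big_map rmorph_prod /=; apply: eq_bigr => e _.
  rewrite /qpoch rmorph_prod /=; apply: eq_bigr => i _.
  by rewrite rmorphB rmorphM rmorphXn rmorph1.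
have [w0 wE] := joukowski_root (f x).
pose G k := qpochs [:: q ^- n; a * b * c * d * q ^ (n%:Z - 1)] q k *
  (\prod_(i < k) (1 - a * q ^+ i * (x *+ 2) + a ^+ 2 * q ^+ i ^+ 2)) /
  qpochs [:: q; a * b; a * c; a * d] q k * q ^+ k.
exists (a ^- n * qpochs [:: a * b; a * c; a * d] q n * \sum_(k < n.+1) G k).
rewrite /askey_wilson qhyp_terminating// !rmorphM -pochsR /=.
rewrite fmorphV rmorphXn !rmorphM rmorph_sum; congr (_ * _).
apply: eq_bigr => k _.
rewrite /qhyp_term /G !rmorphM fmorphV rmorphXn -!pochsR /= !rmorphM.
rewrite fmorphV rmorphXn fmorphXz; congr (_ / _ * _).
rewrite /qpochs !big_cons !big_nil !mulr1 qpoch_pair // wE !mulrA.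
congr (_ * _); rewrite rmorph_prod; apply: eq_bigr => i _.
by rewrite rmorphD rmorphB rmorph1 !rmorphM !rmorphXn rmorphMn.
Qed.

(* Taking the real part in [askey_wilson_real] loses nothing. *)
Lemma askey_wilson_realE (q : R) n (x a b c d : R) : q != 0 ->
  (askey_wilson_real q n x a b c d)%:C =
  askey_wilson q%:C n x%:C a%:C b%:C c%:C d%:C.
Proof.
move=> q0; rewrite /askey_wilson_real.
by have [r ->] := askey_wilson_morph (real_complex R) n x a b c d q0.
Qed.

Definition qJacobi (q alpha beta : R) (n : nat) (x s t : R) : R :=
  askey_wilson_real q n x
    (q `^ (2^-1 + alpha) * s / t) (q `^ 2^-1 * t / s)
    (- q `^ 2^-1 / (s * t)) (- (s * t) * q `^ (2^-1 + beta)).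

Definition qLaguerre (q alpha : R) (n : nat) (x s t : R) : R :=
  askey_wilson_real q n x
    (q `^ (2^-1 + alpha) * s / t) (q `^ 2^-1 * t / s)
    (- q `^ 2^-1 / (s * t)) 0.

Definition big_qJacobi (q alpha beta : R) (n : nat) (x c d : R) : R :=
  qhyp [:: q ^- n; q `^ (n%:R + alpha + beta + 1); q `^ (1 + alpha) * x / c]
       [:: q `^ (alpha + 1); - q `^ (1 + alpha) * d / c] q q.

(* [mu] is the measure dm^(alpha)(.; s, t | q): for 0 < q < 1 and s, t > 0
   exactly one Borel probability measure satisfies these conditions. *)
Definition qLaguerre_measure (q : R) (alpha : nat) (s t : R)
    (mu : probability (measurableTypeR R) R) : Prop :=
  forall i j : nat,
    let f x := qLaguerre q alpha%:R i x s t * qLaguerre q alpha%:R j x s t in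
    mu.-integrable setT (fun x => (f x)%:E) /\
    (\int[mu]_x (f x)%:E =
     ((i == j)%:R * qpochs [:: q; q ^+ alpha.+1; - q * s ^- 2;
                             - q ^+ alpha.+1 * t ^- 2] q j)%:E)%E.

Definition D_const (q : R) (n l : nat) (tau sigma : R) : R :=
  qpochs [:: - q `^ (2 * sigma - l%:R); - q `^ (2 * tau - l%:R)] q (l - n) *
  (qpoch (q ^+ (l - n + 1)) q n / qpoch q q n) *
  qpoch (q ^+ (n + 1)) q l *
  q `^ (2^-1 * (l%:R - n%:R) * (l%:R - n%:R - 2 * sigma - 2 * tau)).

Definition C_const (q : R) (n l m p : nat) (tau sigma : R) : R :=
  D_const q n l tau sigma *
  qpochs [:: q; q ^+ (1 + p); - q `^ (1 - 2 * tau);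
           - q `^ (1 + p%:R - 2 * sigma)] q (m + n).

End AskeyWilson.

(* Main.v *)
(* The integrals I(m,k) = \int p_l l_m l_k dm are the matrix entries, up to the
   norms of the l_k, of p_l(x) acting in the q-Laguerre basis.  Multiplication
   by x is tridiagonal there, and computing \int p_l (2 x l_m) l_k dm in two
   ways gives
     I(m+1,k) + B_m I(m,k) + C_m I(m-1,k) = I(m,k+1) + B_k I(m,k) + C_k I(m,k-1),
   so I is determined by I(0,k).  It then suffices to show that the product of
   big q-Jacobi polynomials satisfies the same recurrence and initial values.

   Recurrence: the forward and backward shift relations of the big q-Jacobi
   polynomials express P_{l-n-1}^{(n+1,n+1)} and P_{l-n+1}^{(n-1,n-1)} at
   neighbouring points through P_{l-n+1}^{(n-1,n-1)} and P_{l-n}^{(n,n)} at a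
   single point, and the recurrence becomes a rational identity.

   Initial values: I(0,k) is a connection coefficient from p_l to the q-Laguerre
   polynomials.  Both families are symmetric in their parameters (by the
   three-term recurrence), and expanded in (c e^{i theta}, c e^{-i theta}; q)_k
   with the common parameter c = -q^{1/2}/(st) they are related by q-binomial
   inversion, which leaves a single 3phi2, the second big q-Jacobi factor. *)
Require Import Defs.
From HB Require Import structures.
From mathcomp Require Import all_boot all_order all_algebra.
From mathcomp Require Import ring zify complex.
From mathcomp Require Import all_classical all_reals all_analysis.

Import Order.TTheory GRing.Theory Num.Theory.
Import numFieldNormedType.Exports.

Local Open Scope classical_set_scope.
Local Open Scope ring_scope.

(* [field] returns its side conditions only up to sign and rearrangement. *)
Ltac nonzero := repeat (apply/andP; split);
  solve [assumption | match goal with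
  | h : is_true (?y != 0) |- is_true (?x != 0) =>
    (suff -> : x = y by exact h); ring
  | h : is_true (?y != 0) |- is_true (?x != 0) =>
    (suff -> : x = - y by rewrite oppr_eq0; exact h); ring end].

(** * q-shifted factorials and truncated sums *)

Lemma qpoch0 {K : numFieldType} (a q : K) : qpoch a q 0 = 1.
Proof. by rewrite /qpoch big_ord0. Qed.

Lemma qpochS {K : numFieldType} (a q : K) k :
  qpoch a q k.+1 = qpoch a q k * (1 - a * q ^+ k).
Proof. by rewrite /qpoch big_ord_recr. Qed.

Lemma qpochSl {K : numFieldType} (a q : K) k :
  qpoch a q k.+1 = (1 - a) * qpoch (a * q) q k.
Proof.
rewrite /qpoch big_ord_recl expr0 mulr1; congr (_ * _).
by apply: eq_bigr => i _; rewrite /= exprS mulrA.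
Qed.

Lemma qpoch_neq0 {K : numFieldType} (a q : K) k :
  (forall i, a * q ^+ i != 1) -> qpoch a q k != 0.
Proof.
move=> aq; apply/prodf_neq0 => i _.
by rewrite subr_eq0 eq_sym.
Qed.

Lemma sum_ord_widen {V : nmodType} (F : nat -> V) m n : (m <= n)%N ->
  (forall i, (m <= i)%N -> F i = 0) -> \sum_(i < m) F i = \sum_(i < n) F i.
Proof.
move=> mn F0; rewrite -!(big_mkord xpredT) (big_cat_nat (leq0n m) mn) /=.
rewrite [X in _ + X]big_nat_cond [X in _ + X]big1 ?addr0 // => i.
by rewrite andbT => /andP[/F0].
Qed.

(** * Askey-Wilson polynomials: three-term recurrence and parameter symmetry *)

(* [aw_base q a x k] is (a e^{i theta}, a e^{-i theta}; q)_k for x = cos theta. *)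
Definition aw_base {K : numFieldType} (q a x : K) k : K :=
  \prod_(i < k) (1 - a * q ^+ i * (x *+ 2) + a ^+ 2 * q ^+ i ^+ 2).

(** [E] is abcd. The symbol with [E * q ^+ n / q] is the one with abcd q^(n-1), written with a
    natural exponent. *)
Definition aw_coef {K : numFieldType} (q E a b c d : K) n k : K :=
  qpoch (q ^- n) q k * qpoch (E * q ^+ n / q) q k /
  (qpoch q q k * qpoch (a * b) q k * qpoch (a * c) q k * qpoch (a * d) q k) *
  q ^+ k.

Definition aw_sum {K : numFieldType} (q a b c d : K) n (x : K) : K :=
  \sum_(k < n.+1) aw_coef q (a * b * c * d) a b c d n k * aw_base q a x k.

(** p_n as an expression in [x] alone, over any numeric field: neither a square root nor e^{i theta}
    enters. *)
Definition aw {K : numFieldType} (q a b c d : K) n (x : K) : K :=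
  a ^- n * (qpoch (a * b) q n * qpoch (a * c) q n * qpoch (a * d) q n) *
  aw_sum q a b c d n x.

(** The last factor of [aw_base q a x k.+1] is affine in [x]; solving for [x *+ 2] makes
    multiplication by it bidiagonal in this basis. *)
Lemma aw_baseS {K : numFieldType} (q a x : K) k :
  q != 0 -> a != 0 ->
  (x *+ 2 - a - a^-1) * aw_base q a x k =
  (a * q ^+ k + a^-1 * q ^- k - a - a^-1) * aw_base q a x k -
  a^-1 * q ^- k * aw_base q a x k.+1.
Proof.
move=> q0 a0; rewrite /aw_base big_ord_recr /=.
have Q0 : q ^+ k != 0 by rewrite expf_neq0.
move: (\prod_(i < k) _) (q ^+ k) Q0 => P Q Q0.
by field; rewrite a0 Q0.
Qed.

Lemma aw_coef_gt {K : numFieldType} (q E a b c d : K) n k :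
  q != 0 -> (n < k)%N -> aw_coef q E a b c d n k = 0.
Proof. by move=> q0 nk; rewrite /aw_coef qpoch_terminating // !mul0r. Qed.

Lemma aw_sum_widen {K : numFieldType} (q a b c d x : K) n M :
  q != 0 -> (n < M)%N ->
  aw_sum q a b c d n x =
  \sum_(k < M) aw_coef q (a * b * c * d) a b c d n k * aw_base q a x k.
Proof.
move=> q0 nM.
pose F k := aw_coef q (a * b * c * d) a b c d n k * aw_base q a x k.
rewrite /aw_sum (@sum_ord_widen _ F _ M) // /F => k nk.
by rewrite aw_coef_gt ?mul0r.
Qed.

Lemma aw_coef0 {K : numFieldType} (q E a b c d : K) n :
  aw_coef q E a b c d n 0 = 1.
Proof. by rewrite /aw_coef !qpoch0 !expr0 !mulr1 invr1 mulr1. Qed.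

(** [awA] and [awC] are the classical A_n and C_n, the recurrence coefficients for the 4phi3 without
    its prefactor. *)
Definition awA {K : numFieldType} (q a b c d : K) n : K :=
  let E := a * b * c * d in let Q := q ^+ n in
  (1 - a * b * Q) * (1 - a * c * Q) * (1 - a * d * Q) * (1 - E * Q / q) /
  (a * (1 - E * Q ^+ 2 / q) * (1 - E * Q ^+ 2)).

Definition awC {K : numFieldType} (q a b c d : K) n : K :=
  let E := a * b * c * d in let Q := q ^+ n in
  a * (1 - Q) * (1 - b * c * Q / q) * (1 - b * d * Q / q) *
  (1 - c * d * Q / q) /
  ((1 - E * Q ^+ 2 / q / q) * (1 - E * Q ^+ 2 / q)).

(** Once all symbols are reduced to common ones, a rational identity in q^n and q^j is left: the
    recurrence of the 4phi3 compared at [aw_base q a x j.+1]. *)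
Lemma aw_coef_rec {K : numFieldType} (q a b c d : K) n j :
  q != 0 -> a != 0 -> (forall k, q ^+ k.+1 != 1) ->
  (forall k, a * b * q ^+ k != 1) -> (forall k, a * c * q ^+ k != 1) ->
  (forall k, a * d * q ^+ k != 1) -> (forall k, a * b * c * d * q ^+ k != 1) ->
  let U := aw_coef q (a * b * c * d) a b c d in
  awA q a b c d n.+1 * (U n.+2 j.+1 - U n.+1 j.+1) +
  awC q a b c d n.+1 * (U n j.+1 - U n.+1 j.+1) =
  (a * q ^+ j.+1 + a^-1 * q ^- j.+1 - a - a^-1) * U n.+1 j.+1 -
  a^-1 * q ^- j * U n.+1 j.
Proof.
move=> q0 a0 q1 ab ac ad aE U.
have nz (y : K) : y != 1 -> 1 - y != 0 by rewrite subr_eq0 eq_sym.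
rewrite /U /aw_coef /awA /awC.
set E := a * b * c * d in aE *.
have Q0 : q ^+ n != 0 by rewrite expf_neq0.
have J0 : q ^+ j != 0 by rewrite expf_neq0.
have HQ : q ^+ n.+1 != 1 by apply: q1.
(* [e1] to [e4] reduce the symbols at indices n and n + 2 to [qpoch (q ^- n.+1) q j] and
   [qpoch (E * q ^+ n.+1 / q) q j]. *)
have e1 : qpoch (q ^- n.+2) q j.+1 = (1 - q ^- n.+2) * qpoch (q ^- n.+1) q j.
  by rewrite qpochSl (exprS q n.+1); congr (_ * qpoch _ _ _); field; rewrite ?q0 ?expf_neq0.
have e2 : qpoch (q ^- n) q j.+1 =
    (1 - q ^+ j / q ^+ n.+1) * (1 - q ^+ j.+1 / q ^+ n.+1) / (1 - q ^- n.+1) *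
    qpoch (q ^- n.+1) q j.
  have h : (1 - q ^- n.+1) * qpoch (q ^- n) q j.+1 = qpoch (q ^- n.+1) q j.+2.
    rewrite [in RHS]qpochSl; congr (_ * qpoch _ _ _).
    by rewrite exprS; field; rewrite ?q0 ?expf_neq0.
  have h1 : 1 - q ^- n.+1 != 0.
    by rewrite nz // invr_eq1.
  have h2 : 1 - q ^+ n.+1 != 0 by rewrite nz.
  apply: (mulfI h1); rewrite h !qpochS.
  move: (qpoch _ _ _) => P; rewrite (exprS q j).
  move: (q ^+ j) (q ^+ n.+1) (expf_neq0 n.+1 q0) h2 => J N hN h3.
  by field; nonzero.
have e3 : qpoch (E * q ^+ n.+2 / q) q j.+1 =
    (1 - E * q ^+ n * q ^+ j.+1) * (1 - E * q ^+ n * q ^+ j) /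
    (1 - E * q ^+ n) * qpoch (E * q ^+ n.+1 / q) q j.
  have h1 : 1 - E * q ^+ n != 0 by rewrite nz.
  apply: (mulfI h1).
  have -> : (1 - E * q ^+ n) * qpoch (E * q ^+ n.+2 / q) q j.+1 = qpoch (E * q ^+ n) q j.+2.
    by rewrite [in RHS]qpochSl; congr (_ * qpoch _ _ _); rewrite !exprS; field.
  rewrite !qpochS.
  have -> : E * q ^+ n.+1 / q = E * q ^+ n by rewrite exprS; field.
  by field.
have e4 : qpoch (E * q ^+ n / q) q j.+1 = (1 - E * q ^+ n / q) * qpoch (E * q ^+ n.+1 / q) q j.
  by rewrite qpochSl; congr (_ * qpoch _ _ _); rewrite exprS; field.
rewrite e1 e2 e3 e4 !(qpochS _ _ j).
have D1 : qpoch q q j != 0 by apply: qpoch_neq0 => i; rewrite -exprS.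
have D2 : qpoch (a * b) q j != 0 by apply: qpoch_neq0.
have D3 : qpoch (a * c) q j != 0 by apply: qpoch_neq0.
have D4 : qpoch (a * d) q j != 0 by apply: qpoch_neq0.
move: (qpoch q q j) (qpoch (a * b) q j) (qpoch (a * c) q j) (qpoch (a * d) q j)
 (qpoch (q ^- n.+1) q j) (qpoch (E * q ^+ n.+1 / q) q j) D1 D2 D3 D4.
move=> d1 d2 d3 d4 w1 w2 D1 D2 D3 D4.
have := nz _ (q1 j); have := nz _ (ab j); have := nz _ (ac j); have := nz _ (ad j).
have := nz _ (aE n); have := nz _ (aE (n + n.+1)%N); have := nz _ (aE (n + n)%N).
have := nz _ (aE (n.+1 + n.+1)%N).
rewrite !exprD !exprS => N8 N7 N6 N5 N4 N3 N2 N1.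
have N9 := nz _ HQ; rewrite exprS in N9.
move: (q ^+ n) (q ^+ j) Q0 J0 N1 N2 N3 N4 N5 N6 N7 N8 N9.
move=> Q J Q0 J0 N1 N2 N3 N4 N5 N6 N7 N8 N9.
rewrite /E in N5 N6 N7 N8 *.
move: N1 N2 N3 N4 N5 N6 N7 N8 N9.
rewrite !(mulrA, expr2).
move=> N1 N2 N3 N4 N5 N6 N7 N8 N9.
by field; nonzero.
Qed.

Lemma aw_sum_rec {K : numFieldType} (q a b c d x : K) n :
  q != 0 -> a != 0 -> (forall k, q ^+ k.+1 != 1) ->
  (forall k, a * b * q ^+ k != 1) -> (forall k, a * c * q ^+ k != 1) ->
  (forall k, a * d * q ^+ k != 1) -> (forall k, a * b * c * d * q ^+ k != 1) ->
  let S := fun n => aw_sum q a b c d n x in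
  (x *+ 2 - a - a^-1) * S n.+1 =
  awA q a b c d n.+1 * (S n.+2 - S n.+1) + awC q a b c d n.+1 * (S n - S n.+1).
Proof.
move=> q0 a0 q1 ab ac ad aE S; rewrite /S.
rewrite /= !(@aw_sum_widen _ _ _ _ _ _ _ _ n.+3) //; last exact/leqW/leqW.
rewrite -!sumrB !mulr_sumr.
rewrite -big_split /=.
under eq_bigr do rewrite mulrCA aw_baseS // mulrBr !mulrA.
rewrite sumrB big_ord_recl /= [X in _ - X]big_ord_recr /=.
rewrite [RHS]big_ord_recl /=.
(* The boundary terms drop out: the top coefficient is zero, and at k = 0 all coefficients are 1, so
   the differences vanish. *)
rewrite (@aw_coef_gt _ _ _ _ _ _ _ _ n.+2) // !mul0r addr0.
rewrite !aw_coef0 !expr0 subrr !mulr0 !addr0 add0r.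
have -> : a * 1 + a^-1 / 1 - a - a^-1 = 0 by field.
rewrite mulr0 mul0r !add0r -sumrB; apply: eq_bigr => i _.
have E1 (u g p v s : K) :
  u * g * p - v / a / s * p = (g * u - a^-1 / s * v) * p by ring.
rewrite E1 /bump /= add1n -(aw_coef_rec q a b c d n i) //.
by ring.
Qed.

(** Coefficients after rescaling by the prefactor a^-n (ab, ac, ad; q)_n. In [awG] the predecessor
    [n.-1] is harmless at n = 0 because 1 - Q is then zero. *)
Definition awN {K : numFieldType} (q a b c d : K) n : K :=
  (1 - a * b * c * d * q ^+ n / q) /
  ((1 - a * b * c * d * q ^+ n ^+ 2 / q) * (1 - a * b * c * d * q ^+ n ^+ 2)).

Definition awB {K : numFieldType} (q a b c d : K) n : K :=
  a + a^-1 - awA q a b c d n - awC q a b c d n.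

Definition awG {K : numFieldType} (q a b c d : K) n : K :=
  let E := a * b * c * d in let Q := q ^+ n in let Q' := q ^+ n.-1 in
  (1 - Q) * (1 - a * b * Q') * (1 - a * c * Q') * (1 - a * d * Q') *
  (1 - b * c * Q') * (1 - b * d * Q') * (1 - c * d * Q') /
  ((1 - E * Q' ^+ 2) * (1 - E * Q' * Q)).

Lemma aw_rec {K : numFieldType} (q a b c d x : K) n :
  q != 0 -> a != 0 -> (forall k, q ^+ k.+1 != 1) ->
  (forall k, a * b * q ^+ k != 1) -> (forall k, a * c * q ^+ k != 1) ->
  (forall k, a * d * q ^+ k != 1) -> (forall k, a * b * c * d * q ^+ k != 1) ->
  let S := fun n => aw q a b c d n x in
  x *+ 2 * S n.+1 =
  awN q a b c d n.+1 * S n.+2 + awB q a b c d n.+1 * S n.+1 +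
  awG q a b c d n.+1 * S n.
Proof.
move=> q0 a0 q1 ab ac ad aE S; rewrite /S /aw.
have := @aw_sum_rec _ q a b c d x n q0 a0 q1 ab ac ad aE.
move=> /=.
move: (aw_sum q a b c d n x) (aw_sum q a b c d n.+1 x)
  (aw_sum q a b c d n.+2 x) => S0 S1 S2 H.
have E1 y : x *+ 2 * (y * S1) =
  y * ((a + a^-1) * S1 + (x *+ 2 - a - a^-1) * S1) by ring.
rewrite E1 {E1}.
rewrite H /awN /awB /awA /awC /awG !qpochS {H}.
have nz (y : K) : y != 1 -> 1 - y != 0 by rewrite subr_eq0 eq_sym.
have := nz _ (aE (n + n.+1)%N); have := nz _ (aE (n + n)%N).
have := nz _ (aE (n.+1 + n.+1)%N).
have Q0 : q ^+ n != 0 by rewrite expf_neq0.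
have A0 : a ^+ n != 0 by rewrite expf_neq0.
rewrite !exprD /= !exprS !(mulrA, expr2, expr0, mulr1).
move: (q ^+ n) (a ^+ n) Q0 A0 (qpoch _ _ _) (qpoch _ _ _) (qpoch _ _ _).
move=> Q A Q0 A0 P1 P2 P3 N1 N2 N3.
by field; nonzero.

Qed.

(* The coefficients of the three-term recurrence are symmetric in a, b, c, d. *)
Lemma aw_swap {K : numFieldType} (q a b c d x : K) n :
  q != 0 -> a != 0 -> c != 0 -> (forall k, q ^+ k.+1 != 1) ->
  (forall k, a * b * q ^+ k != 1) -> (forall k, a * c * q ^+ k != 1) ->
  (forall k, a * d * q ^+ k != 1) -> (forall k, c * b * q ^+ k != 1) ->
  (forall k, c * d * q ^+ k != 1) -> (forall k, a * b * c * d * q ^+ k != 1) ->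
  aw q a b c d n x = aw q c b a d n x.
Proof.
move=> q0 a0 c0 q1 ab ac ad cb cd aE.
have nz (y : K) : y != 1 -> 1 - y != 0 by rewrite subr_eq0 eq_sym.
have eE : a * b * c * d = c * b * a * d by ring.
have ca k : c * a * q ^+ k != 1 by rewrite (mulrC c).
have cE k : c * b * a * d * q ^+ k != 1 by rewrite -eE.
suff : aw q a b c d n x = aw q c b a d n x /\
       aw q a b c d n.+1 x = aw q c b a d n.+1 x by case.
elim: n => [|n [IH0 IH1]].
  split.
    rewrite /aw /aw_sum !big_ord1 !expr0 !invr1 !mul1r !qpoch0 !mulr1 !aw_coef0.
    by rewrite /aw_base !big_ord0.
  rewrite /aw /aw_sum !big_ord_recl !big_ord0 !aw_coef0 /aw_coef /aw_base /=.
  rewrite /bump /= !addn0 !qpochS !qpoch0 !big_ord_recr !big_ord0 /= !expr0 !expr1.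
  have := nz _ (ab 0%N); have := nz _ (ac 0%N); have := nz _ (ad 0%N).
  have := nz _ (cb 0%N); have := nz _ (cd 0%N); have := nz _ (q1 0%N).
  rewrite !expr0 !expr1 !mulr1 => N1 N2 N3 N4 N5 N6.
  by field; nonzero.
split=> //.
have := aw_rec q a b c d x n q0 a0 q1 ab ac ad aE.
have /= := aw_rec q c b a d x n q0 c0 q1 cb ca cd cE.
rewrite -{}IH0 -{}IH1 => -> /=.
have -> : awG q a b c d n.+1 = awG q c b a d n.+1.
  by rewrite /awG /= -eE; congr (_ / _); ring.
have -> : awN q a b c d n.+1 = awN q c b a d n.+1 by rewrite /awN eE.
have -> : awB q a b c d n.+1 = awB q c b a d n.+1.
  rewrite /awB /awA /awC /= -eE.
  have := nz _ (aE (n + n.+1)%N); have := nz _ (aE (n + n)%N).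
  have := nz _ (aE (n.+1 + n.+1)%N).
  have Q0 : q ^+ n != 0 by rewrite expf_neq0.
  rewrite !exprD /= !exprS !(mulrA, expr2).
  move: (q ^+ n) Q0 => Q Q0 N1 N2 N3.
  by field; nonzero.
(* Degree n + 2 is recovered by cancelling [awN], which must be nonzero; its numerator simplifies to
   1 - abcd q^n, which the hypotheses cover. *)
suff N0 : awN q c b a d n.+1 != 0 by move/addIr/addIr/(mulfI N0).
have := nz _ (cE n); have := nz _ (cE (n + n.+1)%N).
have := nz _ (cE (n.+1 + n.+1)%N).
rewrite /awN !exprD /= !exprS !(mulrA, expr2, expr0, mulr1).
move: (q ^+ n) => Q N1 N2 N3.
have -> : (1 - c * b * a * d * q * Q / q) /
    ((1 - c * b * a * d * q * Q * q * Q / q) * (1 - c * b * a * d * q * Q * q * Q)) =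
  (1 - c * b * a * d * Q) /
    ((1 - c * b * a * d * Q * q * Q) * (1 - c * b * a * d * q * Q * q * Q)).
  by field; nonzero.
by rewrite mulf_neq0 // invr_eq0 mulf_neq0.
Qed.

(** * q-binomial inversion and connection coefficients *)

Lemma qpochD {K : numFieldType} (a q : K) m n :
  qpoch a q (m + n) = qpoch a q m * qpoch (a * q ^+ m) q n.
Proof.
rewrite /qpoch big_split_ord /=; congr (_ * _).
by apply: eq_bigr => i _; rewrite exprD mulrA.
Qed.

Lemma qpoch0l {K : numFieldType} (q : K) n : qpoch 0 q n = 1.
Proof. by rewrite /qpoch big1 // => i _; rewrite mul0r subr0. Qed.

(** Factor by factor, 1 - q^(i-k) = -q^(i-k) (1 - q^(k-i)). The product stands for (-1)^n
    q^(n(n-1)/2), so that no halved exponent occurs. *)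
Lemma qpoch_invX {K : numFieldType} (q : K) n k : q != 0 -> (n <= k)%N ->
  qpoch (q ^- k) q n * q ^+ (k * n) * qpoch q q (k - n) =
  \prod_(i < n) (- q ^+ i) * qpoch q q k.
Proof.
move=> q0; elim: n => [|n IH] nk.
  by rewrite qpoch0 muln0 subn0 big_ord0 expr0 !mul1r.
have {}IH := IH (ltnW nk).
rewrite qpochS big_ord_recr /= [RHS]mulrAC -IH.
have -> : (k - n = (k - n.+1).+1)%N by rewrite subnSK.
rewrite qpochS mulnS exprD -exprS subnSK //.
have -> : q ^+ k = q ^+ (k - n) * q ^+ n by rewrite -exprD subnK // ltnW.
have := expf_neq0 n q0; have := expf_neq0 (k - n) q0.
move: (q ^+ n) (q ^+ (k - n)) => N M N0 M0.
by field; nonzero.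
Qed.

Lemma prod_oppX_sqr {K : numFieldType} (q : K) n :
  (\prod_(i < n) (- q ^+ i)) ^+ 2 * q ^+ n = q ^+ (n * n).
Proof.
elim: n => [|n IH]; first by rewrite big_ord0 expr1n mul1r.
rewrite big_ord_recr /= exprMn sqrrN mulSn mulnS addnCA !exprD -IH exprS.
by ring.
Qed.

(* The sum vanishes for m = k + 1 and j <> k because t (k + 1) = 0. *)
Lemma qbinomial_partial_sum {K : numFieldType} (q : K) k j m :
  q != 0 -> (forall i, q ^+ i.+1 != 1) ->
  let t n := qpoch (q ^- k) q n * qpoch (q ^- n) q j * q ^+ (k * n) /
             qpoch q q n in
  (q ^+ k - q ^+ j) * \sum_(n < m) t n = t m * (q ^+ j - q ^+ m).
Proof.
move=> q0 q1 t; elim: m => [|m IH].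
  rewrite big_ord0 mulr0 /t {t}; case: j => [|j]; first by rewrite subrr mulr0.
  by rewrite (qpoch_terminating q0 (ltn0Sn j)) mulr0 !mul0r.
rewrite big_ord_recr /= mulrDr {}IH.
(* Telescoping: the right side has to grow by [t m * (q ^+ k - q ^+ j)], which is a condition on the
   ratio of consecutive terms. *)
suff E1 : t m.+1 * (q ^+ j - q ^+ m.+1) = t m * (q ^+ k - q ^+ m).
  by rewrite E1; ring.
have [mj|jm] := ltnP m j.
  have -> : t m = 0 by rewrite /t (qpoch_terminating q0 mj) mulr0 !mul0r.
  rewrite mul0r; move: mj; rewrite leq_eqVlt => /orP[/eqP <-|mj].
    by rewrite subrr mulr0.
  by rewrite /t (qpoch_terminating q0 mj) mulr0 !mul0r.
have E2 : qpoch (q ^- m.+1) q j * (1 - q ^+ j / q ^+ m.+1) =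
          (1 - q ^- m.+1) * qpoch (q ^- m) q j.
  have -> : q ^- m = q ^- m.+1 * q by rewrite exprS; field; rewrite expf_neq0.
  by rewrite -qpochSl qpochS (mulrC (q ^+ j)).
have N1 : 1 - q ^+ j / q ^+ m.+1 != 0.
  have -> : q ^+ m.+1 = q ^+ j * q ^+ (m - j).+1 by rewrite -exprD addnS subnKC.
  by rewrite invfM mulrA divff ?expf_neq0 // mul1r subr_eq0 eq_sym invr_eq1.
rewrite /t.
have -> : qpoch (q ^- m.+1) q j =
    (1 - q ^- m.+1) * qpoch (q ^- m) q j / (1 - q ^+ j / q ^+ m.+1).
  by rewrite -E2 mulfK.
rewrite !(qpochS _ _ m) mulnS exprD.
have N2 := q1 m; rewrite exprS in N2 N1 *.
have N3 : qpoch q q m != 0 by apply: qpoch_neq0 => i; rewrite -exprS.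
have := expf_neq0 m q0; have := expf_neq0 k q0; have := expf_neq0 j q0.
have N4 : 1 - q * q ^+ m != 0 by rewrite subr_eq0 eq_sym.
move: (qpoch _ _ _) (qpoch _ _ _) (qpoch q q m) N3 => P1 P2 P3 N3.
move: (q ^+ (k * m)) (q ^+ k) (q ^+ m) (q ^+ j) N1 N2 N4.
move=> KM K0 M J N1 N2 N4 H1 H2 H3.
have N5 : q * M - J != 0.
  have -> : q * M - J = (1 - J / (q * M)) * (q * M) by field; nonzero.
  by rewrite !mulf_neq0.
by field; nonzero.
Qed.

(** Exchanging the sums leaves an inner sum over n of the terms in [qbinomial_partial_sum]: it
    vanishes for j <> k, and for j = k only n = k contributes. *)
Lemma qbinomial_inversion {K : numFieldType} (q : K) k (psi : nat -> K) :
  q != 0 -> (forall i j, i != j -> q ^+ i != q ^+ j) ->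
  \sum_(n < k.+1) qpoch (q ^- k) q n / qpoch q q n * q ^+ (k * n) *
    \sum_(j < n.+1) qpoch (q ^- n) q j / qpoch q q j * q ^+ j * psi j = psi k.
Proof.
move=> q0 qinj.
have q1 i : q ^+ i.+1 != 1 by rewrite -[1](expr0 q) qinj.
transitivity (\sum_(n < k.+1) \sum_(j < k.+1)
    (qpoch (q ^- k) q n * qpoch (q ^- n) q j * q ^+ (k * n) / qpoch q q n) *
    (q ^+ j * psi j / qpoch q q j)).
  apply: eq_bigr => n _.
  pose F j := qpoch (q ^- n) q j / qpoch q q j * q ^+ j * psi j.
  rewrite (@sum_ord_widen _ F _ k.+1) // => [|j nj].
    by rewrite mulr_sumr; apply: eq_bigr => j _; rewrite /F; ring.
  by rewrite /F qpoch_terminating // !mul0r.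
rewrite exchange_big /=.
under eq_bigr do rewrite -mulr_suml.
rewrite big_ord_recr /= big1 ?add0r.
  have Q0 : qpoch q q k != 0 by apply: qpoch_neq0 => i; rewrite -exprS.
  rewrite big_ord_recr /= big1 ?add0r.
    have := qpoch_invX q k k q0 (leqnn k).
    rewrite subnn qpoch0 mulr1 => E1.
    have E2 := prod_oppX_sqr q k.
    have N0 : q ^+ (k * k) != 0 by rewrite expf_neq0.
    have -> : qpoch (q ^- k) q k =
        \prod_(i < k) (- q ^+ i) * qpoch q q k / q ^+ (k * k).
      by rewrite -E1 mulfK.
    move: E2 N0 Q0; rewrite expr2; move: (\prod_(i < k) _) (qpoch q q k) => t Q.
    move=> <-.
    rewrite !mulf_eq0 !negb_or -andbA => /and3P[t0 _ k0] Q0.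
    by field; nonzero.
  move=> i _.
  by rewrite (@qpoch_terminating _ q i k) // mulr0 !mul0r.
move=> i _.
have := qbinomial_partial_sum q k i k.+1 q0 q1.
rewrite /= (@qpoch_terminating _ q k k.+1) // !mul0r => /eqP.
rewrite mulf_eq0 subr_eq0 (negPf (qinj _ _ _)) ?(gtn_eqF (ltn_ord i)) //=.
by move=> /eqP ->; rewrite mul0r.
Qed.

(** With d = 0 the symbols in abcd and ad become 1, and the sum takes the shape that
    [qbinomial_inversion] inverts. *)
Lemma aw_d0 {K : numFieldType} (q a b c : K) n x :
  aw q a b c 0 n x = a ^- n * (qpoch (a * b) q n * qpoch (a * c) q n) *
  \sum_(j < n.+1) qpoch (q ^- n) q j / qpoch q q j * q ^+ j *
     (aw_base q a x j / (qpoch (a * b) q j * qpoch (a * c) q j)).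
Proof.
rewrite /aw /aw_sum !mulr0 !qpoch0l mulr1; congr (_ * _).
apply: eq_bigr => j _.
rewrite /aw_coef !mulr0 !mul0r !qpoch0l !mulr1 -!mulrA !invfM.
by ring.
Qed.

Lemma aw_base_expand {K : numFieldType} (q a b c x : K) k :
  q != 0 -> (forall i j, i != j -> q ^+ i != q ^+ j) -> a != 0 ->
  (forall k, a * b * q ^+ k != 1) -> (forall k, a * c * q ^+ k != 1) ->
  aw_base q a x k = qpoch (a * b) q k * qpoch (a * c) q k *
  \sum_(n < k.+1) qpoch (q ^- k) q n / qpoch q q n * q ^+ (k * n) *
    (a ^+ n / (qpoch (a * b) q n * qpoch (a * c) q n) * aw q a b c 0 n x).
Proof.
move=> q0 qinj a0 ab ac.
have B0 n : qpoch (a * b) q n * qpoch (a * c) q n != 0.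
  by rewrite mulf_neq0 // qpoch_neq0.
have := qbinomial_inversion q k (fun j => aw_base q a x j /
   (qpoch (a * b) q j * qpoch (a * c) q j)) q0 qinj.
move=> /(congr1 ( *%R (qpoch (a * b) q k * qpoch (a * c) q k))).
rewrite [in RHS]mulrC divfK // => <-; congr (_ * _).
apply: eq_bigr => n _; rewrite aw_d0; congr (_ * _).
have A0 : a ^+ n != 0 by rewrite expf_neq0.
rewrite [RHS]mulrA -[LHS]mul1r; congr (_ * _).
move: (qpoch _ _ _ * _) (B0 n) (a ^+ n) A0 => P P0 A A0.
by field; nonzero.
Qed.

(** The part of the connection coefficient from p_l(a,b,c,d) to p_n(a,b,e,0) that is free of e;
    [conn_sum] is the remaining terminating 3phi2. *)
Definition conn_coef {K : numFieldType} (q a b c d : K) l n : K :=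
  a ^+ n / a ^+ l *
  (qpoch (a * b) q l * qpoch (a * c) q l * qpoch (a * d) q l) /
  (qpoch q q n * qpoch (a * b) q n) * \prod_(i < n) (- q ^+ i.+1) *
  (qpoch (q ^- l) q n * qpoch (a * b * c * d * q ^+ l / q) q n /
   (qpoch (a * c) q n * qpoch (a * d) q n)).

Definition conn_sum {K : numFieldType} (q a b c d e : K) l n : K :=
  \sum_(j < (l - n).+1)
    qpoch (q ^- (l - n)) q j * qpoch (a * b * c * d * q ^+ (l + n) / q) q j *
    qpoch (a * e * q ^+ n) q j /
    (qpoch q q j * qpoch (a * c * q ^+ n) q j * qpoch (a * d * q ^+ n) q j) *
    q ^+ j.

Lemma prod_oppXS {K : numFieldType} (q : K) n :
  \prod_(i < n) (- q ^+ i.+1) = q ^+ n * \prod_(i < n) (- q ^+ i).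
Proof.
elim: n => [|k IH]; first by rewrite !big_ord0 mulr1.
by rewrite !big_ord_recr /= IH !exprS; ring.
Qed.

(** Both families share a and b: expand p_l in [aw_base q a x k], replace each basis element by
    [aw_base_expand], and exchange the sums. *)
Lemma aw_connection {K : numFieldType} (q a b c d e x : K) l :
  q != 0 -> (forall i j, i != j -> q ^+ i != q ^+ j) -> a != 0 ->
  (forall k, a * b * q ^+ k != 1) -> (forall k, a * c * q ^+ k != 1) ->
  (forall k, a * d * q ^+ k != 1) -> (forall k, a * e * q ^+ k != 1) ->
  aw q a b c d l x = \sum_(n < l.+1)
    conn_coef q a b c d l n * conn_sum q a b c d e l n * aw q a b e 0 n x.
Proof.
move=> q0 qinj a0 ab ac ad ae.
have q1 i : q ^+ i.+1 != 1 by rewrite -[1](expr0 q) qinj.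
have P0 k : qpoch q q k != 0 by apply: qpoch_neq0 => i; rewrite -exprS.
pose T k n := qpoch (q ^- k) q n / qpoch q q n * q ^+ (k * n) *
    (a ^+ n / (qpoch (a * b) q n * qpoch (a * e) q n) * aw q a b e 0 n x).
pose G k := aw_coef q (a * b * c * d) a b c d l k *
            (qpoch (a * b) q k * qpoch (a * e) q k).
pose pre := a ^- l * (qpoch (a * b) q l * qpoch (a * c) q l * qpoch (a * d) q l).
transitivity (pre * \sum_(k < l.+1) \sum_(n < l.+1) G k * T k n).
  congr (_ * _); apply: eq_bigr => k _.
  rewrite (aw_base_expand q a b e x k) // mulrA -/(G k) -mulr_sumr; congr (_ * _).
  rewrite (@sum_ord_widen _ (T k) _ l.+1) // /T => i ki.
  by rewrite qpoch_terminating // !mul0r.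
rewrite exchange_big mulr_sumr; apply: eq_bigr => -[n nl] _ /=.
pose F k := G k * T k n.
transitivity (pre * \sum_(k < l.+1) F k); first by [].
(* Terms with k < n vanish since (q^-k; q)_n = 0; the rest is reindexed by k = n + j. *)
have E1 : l.+1 = (n + (l - n).+1)%N by rewrite addnS subnKC.
rewrite E1 big_split_ord /= big1 ?add0r; last first.
  by move=> i _; rewrite /F /T qpoch_terminating // !mul0r mulr0.
rewrite [RHS]mulrAC /conn_sum !mulr_sumr.
apply: eq_bigr => j _.
have B0 y k : (forall i, y * q ^+ i != 1) -> qpoch y q k != 0 by apply: qpoch_neq0.
rewrite /F /G /T /conn_coef /aw_coef /pre /=.
rewrite prod_oppXS.
have := qpoch_invX q n (n + j) q0 (leq_addr j n).
rewrite addKn => E2.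
have -> : qpoch (q ^- (n + j)) q n =
    \prod_(i < n) (- q ^+ i) * qpoch q q (n + j) / (q ^+ ((n + j) * n) * qpoch q q j).
  by rewrite -E2 -mulrA mulfK // mulf_neq0 // expf_neq0.
have -> : q ^- (l - n) = q ^- l * q ^+ n.
  rewrite -{2}(@subnK n l) // exprD invfM -mulrA mulVf ?mulr1 //.
  by rewrite expf_neq0.
have -> : a * b * c * d * q ^+ (l + n) / q = a * b * c * d * q ^+ l / q * q ^+ n.
  by rewrite exprD; field.
rewrite !(qpochD (q ^- l)) !(qpochD (a * b * c * d * q ^+ l / q)).
rewrite !(qpochD (a * c)) !(qpochD (a * d)) !(qpochD (a * e)).
have sh y : (forall i, y * q ^+ i != 1) -> qpoch (y * q ^+ n) q j != 0.
  by move=> H; apply: B0 => i; rewrite -mulrA -exprD.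
have := sh _ ac; have := sh _ ad; have := B0 _ n ae; have := B0 _ n ad.
have := B0 _ n ac; have := B0 _ n ab; have := B0 _ (n + j)%N ab.
have := P0 n; have := P0 j; have := P0 (n + j)%N.
have := expf_neq0 ((n + j) * n) q0; have := expf_neq0 l a0; rewrite exprD.
move: (q ^+ ((n + j) * n)) (a ^+ l) (qpoch q q _) (qpoch q q _) (qpoch q q _).
move=> d1 d2 d3 d4 d5.
move: (qpoch _ _ (n + j)) (qpoch _ _ n) (qpoch _ _ n) (qpoch _ _ n).
move: (qpoch _ _ n) => d10 d6 d7 d8 d9.
move: (qpoch _ _ j) (qpoch _ _ j) (qpoch _ _ j) (qpoch _ _ j) (qpoch _ _ j).
move: (qpoch _ _ n) (qpoch _ _ n).
move=> d11 d12 d13 d14 d15 d16 d17; do 12 move=> ?.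
by field; nonzero.
Qed.

(** * The recurrence in the q-Laguerre case d = 0 *)

Definition lagB {K : numFieldType} (q a b c : K) n : K :=
  a + a^-1 - (1 - a * b * q ^+ n) * (1 - a * c * q ^+ n) / a -
  a * (1 - q ^+ n) * (1 - b * c * q ^+ n / q).

Definition lagC {K : numFieldType} (q a b c : K) n : K :=
  (1 - q ^+ n) * (1 - a * b * q ^+ n.-1) * (1 - a * c * q ^+ n.-1) *
  (1 - b * c * q ^+ n.-1).

(** With d = 0 the coefficient [awN] becomes 1, while [awB] and [awG] become [lagB] and [lagC]. *)
Lemma laguerre_rec {K : numFieldType} (q a b c x : K) n :
  q != 0 -> a != 0 -> (forall k, q ^+ k.+1 != 1) ->
  (forall k, a * b * q ^+ k != 1) -> (forall k, a * c * q ^+ k != 1) ->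
  let L := fun n => aw q a b c 0 n x in
  x *+ 2 * L n = L n.+1 + lagB q a b c n * L n + lagC q a b c n * L n.-1.
Proof.
move=> q0 a0 q1 ab ac L; rewrite /L.
have n1 : (0 : K) != 1 by rewrite eq_sym oner_eq0.
(* At n = 0 the index [n.-1] is again 0, but [lagC] vanishes; this degree is checked directly
   because [aw_rec] starts at n = 1. *)
case: n => [|n].
  rewrite /aw /aw_sum !big_ord_recl !big_ord0 !aw_coef0 /aw_coef /aw_base /=.
  rewrite /bump /= !addn0 !qpochS !qpoch0 !big_ord_recr !big_ord0 /= !expr0 !expr1.
  have := q1 0%N; have := ab 0%N; have := ac 0%N.
  rewrite /lagB /lagC !expr1 !expr0 !mulr1.
  have nz (y : K) : y != 1 -> 1 - y != 0 by rewrite subr_eq0 eq_sym.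
  move=> /nz N1 /nz N2 /nz N3.
  by field; nonzero.
have /= -> := aw_rec q a b c 0 x n q0 a0 q1 ab ac.
- have -> : awN q a b c 0 n.+1 = 1.
    by rewrite /awN !mulr0 !mul0r !subr0 !mulr1 divff // oner_neq0.
  have -> : awB q a b c 0 n.+1 = lagB q a b c n.+1.
    by rewrite /awB /awA /awC /lagB !mulr0 !mul0r !subr0 !mulr1 !divr1.
  have -> : awG q a b c 0 n.+1 = lagC q a b c n.+1.
    by rewrite /awG /lagC !mulr0 !mul0r !subr0 !mulr1 !divr1.
  by rewrite mul1r.
- by move=> k; rewrite mulr0 mul0r.
- by move=> k; rewrite mulr0 mul0r.
Qed.

(** * Shift relations of the big q-Jacobi polynomials *)

Definition bqj_coef {K : numFieldType} (q : K) M (Q r : K) k : K :=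
  qpoch (q ^- M) q k * qpoch (Q ^+ 2 * q ^+ M / q) q k /
  (qpoch q q k * qpoch Q q k * qpoch (- r * Q) q k) * q ^+ k.

(* With Q = q^(n+1), r = 1/c and u = q^m this is P_M^{(n,n)}(-q^m; c, 1; q). *)
Definition bqj {K : numFieldType} (q : K) M (Q r u : K) : K :=
  \sum_(k < M.+1) bqj_coef q M Q r k * qpoch (- r * u * Q) q k.

Lemma bqj_coef0 {K : numFieldType} (q : K) M (Q r : K) : bqj_coef q M Q r 0 = 1.
Proof. by rewrite /bqj_coef !qpoch0 expr0 !mulr1 invr1 mulr1. Qed.

(** Removing the first factor of each symbol replaces Q by Q q; hence lowering the degree raises
    Q. *)
Lemma bqj_coefS {K : numFieldType} (q : K) M (Q r : K) k :
  q != 0 -> bqj_coef q M.+1 Q r k.+1 =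
  (1 - q ^- M.+1) * (1 - Q ^+ 2 * q ^+ M) * q /
  ((1 - q ^+ k.+1) * (1 - Q) * (1 + r * Q)) * bqj_coef q M (Q * q) r k.
Proof.
move=> q0; rewrite /bqj_coef.
rewrite (qpochSl (q ^- _)) (qpochSl (Q ^+ 2 * _ / _)) (qpochSl Q).
rewrite (qpochSl (- r * Q)) (qpochS q).
have -> : q ^- M.+1 * q = q ^- M by rewrite (exprS q M); field; rewrite q0 expf_neq0.
have -> : Q ^+ 2 * q ^+ M.+1 / q * q = (Q * q) ^+ 2 * q ^+ M / q.
  by rewrite (exprS q M); field.
have -> : Q ^+ 2 * q ^+ M.+1 / q = Q ^+ 2 * q ^+ M by rewrite (exprS q M); field.
rewrite -!mulrA -exprS (exprS q k) mulNr opprK !invfM.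
by ring.
Qed.

(** The difference of (-r u Q; q)_k under u -> u q is a multiple of (-r u Q q; q)_(k-1), and
    [bqj_coefS] absorbs the constants. *)
Lemma bqj_forward {K : numFieldType} (q : K) M (Q r u : K) :
  q != 0 -> (forall k, q ^+ k.+1 != 1) -> 1 - Q != 0 -> 1 + r * Q != 0 ->
  bqj q M.+1 Q r u - bqj q M.+1 Q r (u * q) =
  r * u * Q * q * (1 - q ^- M.+1) * (1 - Q ^+ 2 * q ^+ M) /
  ((1 - Q) * (1 + r * Q)) * bqj q M (Q * q) r u.
Proof.
move=> q0 q1 Q1 rQ; rewrite /bqj -sumrB big_ord_recl /= !qpoch0 subrr add0r mulr_sumr.
apply: eq_bigr => k _; rewrite /bump /= add1n bqj_coefS //.
rewrite (qpochSl (- r * u * Q)) qpochS.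
have -> : - r * (u * q) * Q = - r * u * Q * q by ring.
rewrite -(mulrA (- r * u)).
have N : 1 - q ^+ k.+1 != 0 by rewrite subr_eq0 eq_sym q1.
rewrite !invfM exprS in N *; move: (q ^+ k) N => J N.
have M0 := expf_neq0 M.+1 q0.
by field; nonzero.
Qed.

(** With y = -r u Q both terms on the left are combinations of (y; q)_k and (y; q)_(k+1); collecting
    equal lengths gives the coefficients on the right. *)
Lemma bqj_backward {K : numFieldType} (q : K) M (Q r u : K) :
  q != 0 -> Q != 0 -> (forall k, q ^+ k.+1 != 1) ->
  (forall k, Q * q ^+ k != 1) -> (forall k, - r * Q * q ^+ k != 1) ->
  (1 - u) * (1 + r * u) * bqj q M (Q * q) r (u / q) -
  (1 - u * Q) * (1 + r * u * Q) * bqj q M (Q * q) r u =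
  u * ((1 - Q) * (1 + r * Q) / Q) * bqj q M.+1 Q r u.
Proof.
move=> q0 Q0 q1 Q1 rQ.
have nz (y : K) : y != 1 -> 1 - y != 0 by rewrite subr_eq0 eq_sym.
pose y := - r * u * Q; pose a := bqj_coef q M (Q * q) r.
(* After the common factor u is taken out, the remaining u is removed through y q^k = 1 - (1 - y
   q^k), which distributes it over [A] and [B]. *)
pose A k := a k * (r * (1 - Q * q ^+ k) - (1 - Q) +
                  (1 - Q ^+ 2 * q ^+ k) / (Q * q ^+ k)) * qpoch y q k.
pose B k := a k * ((1 - Q ^+ 2 * q ^+ k) / (Q * q ^+ k)) * qpoch y q k.+1.
transitivity (u * (\sum_(k < M.+1) A k - \sum_(k < M.+1) B k)).
  rewrite /bqj -sumrB !mulr_sumr -sumrB; apply: eq_bigr => k _.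
  have -> : - r * (u / q) * (Q * q) = y by rewrite /y; field.
  have -> : - r * u * (Q * q) = y * q by rewrite /y; ring.
  have -> : 1 + r * u * Q = 1 - y by rewrite /y; ring.
  have E (s t p : K) : s * (1 - y) * (t * p) = s * t * ((1 - y) * p) by ring.
  rewrite E -qpochSl /A /B !qpochS -/a.
  rewrite /y; have := expf_neq0 k q0; move: (q ^+ k) => J J0.
  by field; nonzero.
(* The added term of [A] is zero, and the longer sum lines up with that of [B] shifted by one. *)
have -> : \sum_(k < M.+1) A k = \sum_(k < M.+2) A k.
  apply: sum_ord_widen => // k Mk; rewrite /A /a /bqj_coef qpoch_terminating //.
  by rewrite !mul0r.
rewrite -mulrA; congr (_ * _).
rewrite /bqj !(big_ord_recl M.+1) /= -addrA -sumrB mulrDr; congr (_ + _).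
  by rewrite /A /a !bqj_coef0 !qpoch0 !expr0; field; nonzero.
rewrite mulr_sumr; apply: eq_bigr => k _.
rewrite /A /B /bump /= add1n bqj_coefS // -/a -/y.
have -> : a k.+1 = a k * ((1 - q ^+ k / q ^+ M) * (1 - Q ^+ 2 * q ^+ M.+1 * q ^+ k)
   * q / ((1 - q ^+ k.+1) * (1 - Q * q ^+ k.+1) * (1 + r * Q * q ^+ k.+1))).
  have shift (y' : K) : (forall i, y' * q ^+ i != 1) -> qpoch (y' * q) q k != 0.
    by move=> H; apply: qpoch_neq0 => i; rewrite -mulrA -exprS.
  have P0 : qpoch q q k != 0 by apply: qpoch_neq0 => i; rewrite -exprS.
  have := P0; have := shift _ Q1; have := shift _ rQ.
  have := nz _ (q1 k); have := nz _ (Q1 k.+1); have := nz _ (rQ k.+1).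
  rewrite /a /bqj_coef !qpochS !(exprS q) !mulrA => n1 n2 n3 n4 n5 n6.
  move: (qpoch _ _ k) (qpoch _ _ k) (qpoch q q k) (qpoch _ _ k) (qpoch _ _ k) n4 n5 n6.
  move=> p1 p2 p3 p4 p5 n4 n5 n6.
  have := expf_neq0 k q0; have := expf_neq0 M q0.
  move: (q ^+ k) (q ^+ M) n1 n2 n3 => J W n1 n2 n3 W0 J0.
  by field; nonzero.
have N1 := nz _ (q1 k). have N2 := nz _ (Q1 k.+1). have N3 := nz _ (rQ k.+1).
have N4 := nz _ (Q1 0%N). have N5 := nz _ (rQ 0%N).
rewrite !expr0 !mulr1 in N4 N5; rewrite !mulNr !opprK in N5 N3.
rewrite !(exprS q) in N1 N2 N3 *.
have J0 := expf_neq0 k q0; have W0 := expf_neq0 M q0.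
move: (qpoch y q k.+1) (a k) => P ak.
move: (q ^+ k) (q ^+ M) N1 N2 N3 J0 W0 => J W N1 N2 N3 J0 W0.
by field; nonzero.
Qed.

(* [bqj_backward] at P, after a forward shift of its first term, divided by u. *)
Lemma bqj_backward2 {K : numFieldType} (q : K) M (P r u : K) :
  q != 0 -> P != 0 -> u != 0 -> (forall k, q ^+ k.+1 != 1) ->
  (forall k, P * q ^+ k != 1) -> (forall k, - r * P * q ^+ k != 1) ->
  r * P * q * (1 - q ^- M.+1) * (1 - P ^+ 2 * q ^+ M.+2) /
    ((1 - P * q) * (1 + r * P * q)) *
    ((1 - u) * (1 + r * u) * bqj q M (P * q * q) r (u / q)) =
  (1 - P) * (1 + r * P) / P * bqj q M.+2 P r u -
  ((r - 1) * (1 - P) - r * u * (1 - P ^+ 2)) * bqj q M.+1 (P * q) r u.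
Proof.
move=> q0 P0 u0 q1 P1 rP; apply: (mulfI u0).
have nz (y : K) : y != 1 -> 1 - y != 0 by rewrite subr_eq0 eq_sym.
have N1 := nz _ (P1 1%N); have N2 := nz _ (rP 1%N).
rewrite !expr1 in N1 N2; rewrite !mulNr opprK in N2.
have E1 := bqj_backward q M.+1 P r u q0 P0 q1 P1 rP.
have := bqj_forward q M (P * q) r (u / q) q0 q1 N1.
rewrite [r * (P * q)]mulrA => /(_ N2) E2.
rewrite divfK // in E2.
rewrite [in RHS]mulrBr [u * (_ * bqj _ _ _ _ _)]mulrA -E1.
have -> : bqj q M.+1 (P * q) r (u / q) = bqj q M.+1 (P * q) r u +
 (bqj q M.+1 (P * q) r (u / q) - bqj q M.+1 (P * q) r u) by ring.
rewrite E2 !(exprS q) !mulrA in N1 N2 *.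
have := expf_neq0 M q0; move: (q ^+ M) => W W0.
by field; nonzero.
Qed.

(** * The rational identity behind the kernel recurrence *)

(* Here P = q^n, M = l - n - 1 (with n the middle index) and d P (M + 1),
   d (P q) M are the ratios D^{n-1,l} / D^{n,l} and D^{n,l} / D^{n+1,l}. *)
Lemma kernel_commutation {K : numFieldType} (q : K) M (P r s u v eta : K) :
  q != 0 -> P != 0 -> u != 0 -> v != 0 -> r != 0 -> s != 0 ->
  eta ^+ 2 = q * r * s ->
  (forall k, q ^+ k.+1 != 1) ->
  (forall k, P * q ^+ k != 1) -> (forall k, P ^+ 2 * q ^+ k != 1) ->
  (forall k, - r * P * q ^+ k != 1) -> (forall k, - s * P * q ^+ k != 1) ->
  let d P M := (1 + s * P) * (1 + r * P) * (1 - P) ^+ 2 * q ^+ M * eta /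
    (r * s * P ^+ 2 * (1 - P ^+ 2 * q ^+ M) * (1 - q ^+ M.+1)) in
  let C u v := (1 - u) * (1 - v) * (1 + s * v) * (1 + r * u) in
  d P M.+1 * d (P * q) M *
  (bqj q M.+2 P r (u * q) * bqj q M.+2 P s (v * q) -
   bqj q M.+2 P r u * bqj q M.+2 P s v) =
  C (u * P * q) (v * P * q) *
     (bqj q M (P * q * q) r u * bqj q M (P * q * q) s v) -
  C u v * (bqj q M (P * q * q) r (u / q) * bqj q M (P * q * q) s (v / q)) +
  eta * ((v / r + u / s - u - v) * (P - 1) + u * v * (q + 1) * (P ^+ 2 - 1)) *
  d (P * q) M * (bqj q M.+1 (P * q) r u * bqj q M.+1 (P * q) s v).
Proof.
move=> q0 P0 u0 v0 r0 s0 etaE q1 P1 PP1 rP sP d C.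
have nz (y : K) : y != 1 -> 1 - y != 0 by rewrite subr_eq0 eq_sym.
have Pq0 : P * q != 0 by rewrite mulf_neq0.
have Pq1 k : P * q * q ^+ k != 1 by rewrite -mulrA -exprS.
have rPq k : - r * (P * q) * q ^+ k != 1 by rewrite mulrA -mulrA -exprS.
have sPq k : - s * (P * q) * q ^+ k != 1 by rewrite mulrA -mulrA -exprS.
have := bqj_backward q M (P * q) r u q0 Pq0 q1 Pq1 rPq.
have := bqj_backward q M (P * q) s v q0 Pq0 q1 Pq1 sPq.
have := bqj_backward2 q M P r u q0 P0 u0 q1 P1 rP.
have := bqj_backward2 q M P s v q0 P0 v0 q1 P1 sP.
have N1 := nz _ (P1 0%N); have N2 := nz _ (rP 0%N); have N3 := nz _ (sP 0%N).
have N4 := nz _ (P1 1%N); have N5 := nz _ (rP 1%N); have N6 := nz _ (sP 1%N).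
rewrite expr1 !mulNr !opprK in N4 N5 N6; rewrite expr0 !mulr1 !mulNr !opprK in N1 N2 N3.
have := bqj_forward q M.+1 P r u q0 q1 N1 N2.
have := bqj_forward q M.+1 P s v q0 q1 N1 N3.
have := nz _ (PP1 M.+1); have := nz _ (PP1 M.+2).
have := nz _ (q1 M); have := nz _ (q1 M.+1).
rewrite /C /d => n1 n2 n3 n4.
set f1 := bqj q M.+2 P r u; set f1' := bqj q M.+2 P r (u * q).
set g1 := bqj q M.+2 P s v; set g1' := bqj q M.+2 P s (v * q).
set f := bqj q M.+1 _ r u; set g := bqj q M.+1 _ s v.
set f2 := bqj q M _ r u; set f2' := bqj q M _ r _.
set g2 := bqj q M _ s v; set g2' := bqj q M _ s _.
move=> eg1 ef1 eY' eY eX' eX.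
(* [eta] occurs only in products of two, so [etaE] eliminates it before the field identity. *)
have EL (a b a' b' z : K) :
  a * eta / b * (a' * eta / b') * z = q * r * s * (a / b * (a' / b') * z).
  by rewrite -etaE; ring.
have ER (b a' b' z : K) :
  eta * b * (a' * eta / b') * z = q * r * s * (b * (a' / b') * z).
  by rewrite -etaE; ring.
rewrite EL ER {EL ER etaE}.
have k0 : 1 - q ^- M.+1 != 0.
  by rewrite subr_eq0 eq_sym invr_eq1 q1.
have K1 : r * P * q * (1 - q ^- M.+1) * (1 - P ^+ 2 * q ^+ M.+2) /
    ((1 - P * q) * (1 + r * P * q)) != 0.
  by rewrite !mulf_neq0 // invr_neq0 // mulf_neq0.
have K2 : s * P * q * (1 - q ^- M.+1) * (1 - P ^+ 2 * q ^+ M.+2) /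
    ((1 - P * q) * (1 + s * P * q)) != 0.
  by rewrite !mulf_neq0 // invr_neq0 // mulf_neq0.
(* The six shift relations are solved for the values at neighbouring points and at [P * q * q]; only
   [f1], [g1], [f] and [g] remain. *)
have {eY}Y := canRL (mulKf K1) eY.
have {eY'}Y' := canRL (mulKf K2) eY'.
have {eX}X := canRL (subKr _) eX.
have {eX'}X' := canRL (subKr _) eX'.
have {ef1}-> := canRL (subKr _) ef1.
have {eg1}-> := canRL (subKr _) eg1.
set CC := (X in _ = X - _ + _).
have -> : CC = ((1 - u * (P * q)) * (1 + r * u * (P * q)) * f2) *
  ((1 - v * (P * q)) * (1 + s * v * (P * q)) * g2) by rewrite /CC; ring.
set DD := (X in _ = _ - X + _).
have -> : DD = ((1 - u) * (1 + r * u) * f2') * ((1 - v) * (1 + s * v) * g2').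
  by rewrite /DD; ring.
rewrite X X' Y Y' {CC DD X X' Y Y' K1 K2}.
move: f1 g1 f g => {f1' g1' f2 g2 f2' g2'} f1 g1 f g.
move: k0 n1 n2 n3 n4; rewrite !(exprS q).
have := expf_neq0 M q0; move: (q ^+ M) => W W0 k0 n1 n2 n3 n4.
by field; nonzero.
Qed.

(** The boundary case M = -1 of [kernel_commutation]: terms of degree M are absent, those of degree
    M + 1 are 1, and the linear ones are expanded. *)
Lemma kernel_commutation_top {K : numFieldType} (q P r s u v eta : K) :
  q != 0 -> q != 1 -> P != 0 -> r != 0 -> s != 0 -> 1 - P != 0 ->
  1 - P ^+ 2 != 0 -> 1 + r * P != 0 -> 1 + s * P != 0 ->
  (1 + s * P) * (1 + r * P) * (1 - P) ^+ 2 * eta /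
    (r * s * P ^+ 2 * (1 - P ^+ 2) * (1 - q)) *
  (bqj q 1 P r (u * q) * bqj q 1 P s (v * q) - bqj q 1 P r u * bqj q 1 P s v) =
  eta * ((v / r + u / s - u - v) * (P - 1) + u * v * (q + 1) * (P ^+ 2 - 1)).
Proof.
move=> q0 q1 P0 r0 s0 P1 PP1 rP sP.
have N : 1 - q != 0 by rewrite subr_eq0 eq_sym.
rewrite /bqj !big_ord_recl !big_ord0 /bqj_coef /=.
rewrite /bump /= !qpochS !qpoch0 !expr0 !expr1.
by field; nonzero.
Qed.

(** * The kernel and its recurrence, with all parameters rational in h = q^(1/2), s and t *)

Section Kernel.
Variables (R : realFieldType) (h s t : R) (p : nat).
Hypotheses (h0 : 0 < h) (h1 : h < 1) (s0 : 0 < s) (t0 : 0 < t).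
Let q := h ^+ 2.
Let a := q ^+ p * h * s / t.
Let b := h * t / s.
Let c := - h / (s * t).

(* D^{n,l}(tau, sigma) with h = q^{1/2}, s = q^tau and t = q^sigma. *)
Definition legendre_const l n : R :=
  qpoch (- (t ^+ 2 / q ^+ l)) q (l - n) * qpoch (- (s ^+ 2 / q ^+ l)) q (l - n) *
  (qpoch (q ^+ (l - n).+1) q n / qpoch q q n) * qpoch (q ^+ n.+1) q l *
  (h ^+ ((l - n) * (l - n)) / (s * t) ^+ (l - n)).

Definition lag_norm k : R :=
  qpochs [:: q; q ^+ p.+1; - q * s ^- 2; - q ^+ p.+1 * t ^- 2] q k.

(* The value of \int p_l l_m l_(m+n) dm divided by the squared norm of l_(m+n). *)
Definition legendre_kernel l n m : R :=
  if (n <= l)%N then legendre_const l n *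
    (bqj q (l - n) (q ^+ n.+1) (s ^- 2) (q ^+ m) *
     bqj q (l - n) (q ^+ n.+1) (t ^- 2) (q ^+ (m + p)))
  else 0.

Let h_neq0 : h != 0. Proof. by rewrite gt_eqF. Qed.
Let s_neq0 : s != 0. Proof. by rewrite gt_eqF. Qed.
Let t_neq0 : t != 0. Proof. by rewrite gt_eqF. Qed.
Let c_neq0 : c != 0. Proof. by rewrite mulf_neq0 ?oppr_eq0 ?invr_neq0 ?mulf_neq0. Qed.
Let q_gt0 : 0 < q. Proof. by rewrite exprn_gt0. Qed.
Let q_neq0 : q != 0. Proof. by rewrite gt_eqF. Qed.
Let q_lt1 : q < 1. Proof. by rewrite expr_lt1 // ltW. Qed.
Let qXS_neq1 k : q ^+ k.+1 != 1.
Proof. by rewrite lt_eqF // exprn_ilt1 // ltW. Qed.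
Let qX_inj i j : i != j -> q ^+ i != q ^+ j.
Proof.
apply: contra => /eqP E; apply/eqP; move: E.
by apply: ieexprIn => //; rewrite lt_eqF.
Qed.
Let neg_neq1 (x : R) : x <= 0 -> x != 1.
Proof. by move=> x0; rewrite lt_eqF // (le_lt_trans x0). Qed.

(** In a recurrence with leading coefficient 1, C_(k+1) is the ratio of consecutive squared
    norms. *)
Lemma lag_normS k : lag_norm k.+1 = lag_norm k * lagC q a b c k.+1.
Proof.
rewrite /lag_norm /qpochs !big_cons !big_nil !qpochS /lagC /= -exprS.
rewrite /a /b /c /q; have := expf_neq0 k q_neq0; rewrite /q.
move: (qpoch _ _ k) (qpoch _ _ k) (qpoch _ _ k) (qpoch _ _ k).
rewrite !(exprS (h ^+ 2)); move: ((h ^+ 2) ^+ k) ((h ^+ 2) ^+ p) => W V w1 w2 w3 w4 W0.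
by field; nonzero.
Qed.

(** This ratio is the factor [d] of [kernel_commutation] at P = q^(n+1), with s^-2, t^-2 and h / (s
    t) for its [r], [s] and [eta]. *)
Lemma legendre_const_rec l n : (n < l)%N ->
  legendre_const l n = (1 + t ^- 2 * q ^+ n.+1) * (1 + s ^- 2 * q ^+ n.+1) *
   (1 - q ^+ n.+1) ^+ 2 * q ^+ (l - n.+1) * (h / (s * t)) /
   (s ^- 2 * t ^- 2 * q ^+ n.+1 ^+ 2 * (1 - q ^+ n.+1 ^+ 2 * q ^+ (l - n.+1)) *
    (1 - q ^+ (l - n.+1).+1)) * legendre_const l n.+1.
Proof.
move=> nl; rewrite /legendre_const -(subnSK nl).
set M := (l - n.+1)%N; set Q := q ^+ n.+1.
have lE : l = (n.+1 + M)%N by rewrite subnKC.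
have QM : q ^+ l = Q * q ^+ M by rewrite lE exprD.
have Q0 : Q != 0 by rewrite expf_neq0.
have N1 : 1 - Q ^+ 2 * q ^+ M != 0.
  by rewrite expr2 -mulrA -QM -exprD addSn subr_eq0 eq_sym qXS_neq1.
have N2 : 1 - Q != 0 by rewrite subr_eq0 eq_sym qXS_neq1.
have N3 : 1 - q ^+ M.+1 != 0 by rewrite subr_eq0 eq_sym qXS_neq1.
have -> : qpoch Q q l = (1 - Q) * qpoch (q ^+ n.+2) q l / (1 - Q ^+ 2 * q ^+ M).
  have -> : q ^+ n.+2 = Q * q by rewrite exprSr.
  by rewrite -qpochSl qpochS QM mulrA -expr2 mulfK.
rewrite (qpochSl (q ^+ M.+1)) -exprSr !(qpochS _ _ M) (qpochS q q n) -exprS.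
rewrite -/Q QM.
have -> : h ^+ (M.+1 * M.+1) = h ^+ (M * M) * q ^+ M * h.
  by rewrite -exprM -exprD -exprSr; congr (_ ^+ _); ring.
have P0 : qpoch q q n != 0 by apply: qpoch_neq0 => i; rewrite -exprS.
have W0 : q ^+ M != 0 by rewrite expf_neq0.
have S0 : (s * t) ^+ M != 0 by rewrite expf_neq0 // mulf_neq0.
rewrite [(s * t) ^+ _.+1]exprS.
move: N1 N2 N3 P0 W0 S0; rewrite (exprS q M).
move: (qpoch q q n) (q ^+ M) ((s * t) ^+ M) Q Q0 {QM} => P W S Q Q0 N1 N2 N3 P0 W0 S0.
move: (qpoch _ _ n) (qpoch _ _ l) (qpoch _ _ M) (qpoch _ _ M) (h ^+ _) => w1 w2 w3 w4 w5.
by field; nonzero.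
Qed.

(** The q-Legendre parameters are [a0], [b], [c], [d]; they share [b] and [c] with the q-Laguerre
    parameters, and [a0] is [a] at p = 0. *)
Let a0 := h * s / t.
Let d := - (s * t) * h.

Let cbE : c * b = - s ^- 2 * q.
Proof. by rewrite /c /b /q; field; nonzero. Qed.
Let caE : c * a0 = - t ^- 2 * q.
Proof. by rewrite /c /a0 /q; field; nonzero. Qed.
Let cdE : c * d = q.
Proof. by rewrite /c /d /q; field; nonzero. Qed.
Let cbadE : c * b * a0 * d = q ^+ 2.
Proof. by rewrite cbE -mulrA /a0 /d /q; field; nonzero. Qed.
Let neg_neq (x y : R) k : 0 < x -> 0 < y -> - x * y * q ^+ k != 1.
Proof.
move=> x0 y0; apply: neg_neq1.
by rewrite !mulNr oppr_le0 !mulr_ge0 // ?exprn_ge0 // ltW.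
Qed.
Let inv2_gt0 (x : R) : 0 < x -> 0 < x ^- 2.
Proof. by move=> x0; rewrite invr_gt0 exprn_gt0. Qed.

(** Induction on l - n: both sides have the same ratio between n and n + 1, because the big q-Jacobi
    factor at u = 1 changes by a simple factor. *)
Lemma conn_coefE l n : (n <= l)%N ->
  conn_coef q c b a0 d l n =
  legendre_const l n * bqj q (l - n) (q ^+ n.+1) (s ^- 2) 1.
Proof.
have P0 k : qpoch q q k != 0 by apply: qpoch_neq0 => i; rewrite -exprS.
have CB k : qpoch (c * b) q k != 0.
  by apply: qpoch_neq0 => i; rewrite cbE neg_neq ?inv2_gt0.
have CA k : qpoch (c * a0) q k != 0.
  by apply: qpoch_neq0 => i; rewrite caE neg_neq ?inv2_gt0.
have qX0 k : q ^+ k != 0 by rewrite expf_neq0.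
move: {2}(l - n)%N (erefl (l - n)%N) => k; elim: k n => [|k IH] n ln nl.
  have -> : n = l by apply/eqP; rewrite eqn_leq nl -subn_eq0 ln eqxx.
  rewrite /legendre_const subnn muln0 !qpoch0 expr0 divr1 expr1 !mul1r.
  rewrite /bqj big_ord1 bqj_coef0 qpoch0 !mulr1 divff // mul1r.
  rewrite /conn_coef cdE cbadE prod_oppXS.
  have := qpoch_invX q l l q_neq0 (leqnn l).
  rewrite subnn qpoch0 mulr1 => e1.
  have -> : q ^+ 2 * q ^+ l / q = q ^+ l.+1 by rewrite (exprS q l); field.
  have -> : qpoch (q ^- l) q l =
      \prod_(i < l) (- q ^+ i) * qpoch q q l / q ^+ (l * l) by rewrite -e1 mulfK.
  have := qX0 (l * l)%N; rewrite -prod_oppX_sqr expr2 => N0.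
  move: (P0 l) (CA l) (CB l) (expf_neq0 l c_neq0) N0.
  move: (qpoch q q l) (qpoch _ _ l) (qpoch _ _ l) (c ^+ l) (\prod_(i < l) _).
  move=> w1 w2 w3 w4 w5 n1 n2 n3 n4.
  rewrite !mulf_eq0 !negb_or -andbA => /and3P[n5 _ n6].
  by field; nonzero.
have {}nl : (n < l)%N by rewrite -subn_gt0 ln.
have Mk : (l - n.+1)%N = k by rewrite subnS ln.
have lE : l = (n.+1 + k)%N by rewrite -Mk subnKC.
have := IH n.+1 Mk nl; rewrite Mk ln => {}IH.
rewrite legendre_const_rec // Mk.
set Q := q ^+ n.+1.
have Q0 : Q != 0 by rewrite qX0.
have N2 : 1 - Q != 0 by rewrite subr_eq0 eq_sym qXS_neq1.
have N3 : 1 - q ^+ k.+1 != 0 by rewrite subr_eq0 eq_sym qXS_neq1.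
have rQ : 1 + s ^- 2 * Q != 0.
  by rewrite gt_eqF // ltr_wpDr // mulr_ge0 ?invr_ge0 ?exprn_ge0 ?ltW.
have sQ : 1 + t ^- 2 * Q != 0.
  by rewrite gt_eqF // ltr_wpDr // mulr_ge0 ?invr_ge0 ?exprn_ge0 ?ltW.
(* At u = 1 the first term of [bqj_backward] carries the factor 1 - u = 0, so the relation has only
   two terms. *)
have -> : bqj q k.+1 Q (s ^- 2) 1 = - Q * bqj q k (q ^+ n.+2) (s ^- 2) 1.
  have := bqj_backward q k Q (s ^- 2) 1 q_neq0 Q0 qXS_neq1.
  rewrite subrr !mul0r sub0r !mul1r !mulr1 -exprSr.
  have Q1 i : Q * q ^+ i != 1 by rewrite -exprD addSn.
  have rQ1 i : - s ^- 2 * Q * q ^+ i != 1 by rewrite neg_neq ?inv2_gt0 ?exprn_gt0.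
  move=> /(_ Q1 rQ1) => E.
  have C0 : (1 - Q) * (1 + s ^- 2 * Q) / Q != 0.
    by rewrite !mulf_neq0 // invr_neq0.
  by apply: (mulfI C0); rewrite -E; field; nonzero.
transitivity (- Q * ((1 + t ^- 2 * Q) * (1 + s ^- 2 * Q) *
   (1 - Q) ^+ 2 * q ^+ k * (h / (s * t)) /
   (s ^- 2 * t ^- 2 * Q ^+ 2 * (1 - Q ^+ 2 * q ^+ k) *
    (1 - q ^+ k.+1))) * conn_coef q c b a0 d l n.+1); last by rewrite IH; ring.
rewrite /conn_coef !(qpochS _ _ n) big_ord_recr /=.
rewrite cbadE.
have N4 : 1 - Q ^+ 2 * q ^+ k != 0.
  by rewrite expr2 -mulrA -!exprD addSn subr_eq0 eq_sym qXS_neq1.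
have n1 : 1 - c * b * q ^+ n != 0.
  by rewrite subr_eq0 eq_sym cbE neg_neq ?inv2_gt0.
have n2 : 1 - c * a0 * q ^+ n != 0.
  by rewrite subr_eq0 eq_sym caE neg_neq ?inv2_gt0.
have CD : qpoch (c * d) q n != 0 by rewrite cdE P0.
have qlE : q ^+ l = q ^+ n * q * q ^+ k by rewrite lE exprD exprSr.
move: (P0 n) (CA n) (CB n) CD (expf_neq0 n c_neq0) (expf_neq0 l c_neq0).
rewrite (exprSr c).
move: (qpoch q q n) (qpoch _ _ n) (qpoch _ _ n) (qpoch _ _ n) (c ^+ n) (c ^+ l).
move: (qpoch _ _ n) (qpoch _ _ n) (qpoch _ _ l) (qpoch _ _ l) (qpoch _ _ l).
move: (\prod_(i < n) _) => w1 w2 w3 w4 w5 w6 w7 w8 w9 w10 w11 w12 M1 M2 M3 M4 M5 M6.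
rewrite qlE; move: Q0 N2 N3 rQ sQ N4; rewrite /Q !(exprSr q).
have pos x : 0 < x -> x ^+ 2 + h ^+ 2 * q ^+ n != 0.
  by move=> x0; rewrite gt_eqF // addr_gt0 ?mulr_gt0 ?exprn_gt0.
move: (pos _ s0) (pos _ t0) n1 n2 => {pos} S2 T2; rewrite cdE cbE caE.
move: (q ^+ n) (q ^+ k) (qX0 n) (qX0 k) S2 T2 => W J W0 J0 S2 T2.
rewrite /c /q => n1 n2 Q0 N2 N3 rQ sQ N4.
by field; nonzero.
Qed.

(** The product [c * a] carries the extra power q^p, which becomes the point u = q^p of the second
    big q-Jacobi factor. *)
Lemma conn_sumE l n : (n <= l)%N ->
  conn_sum q c b a0 d a l n = bqj q (l - n) (q ^+ n.+1) (t ^- 2) (q ^+ p).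
Proof.
move=> nl; rewrite /conn_sum /bqj; apply: eq_bigr => j _.
rewrite /bqj_coef cbadE caE cdE.
have -> : q ^+ 2 * q ^+ (l + n) / q = (q ^+ n.+1) ^+ 2 * q ^+ (l - n) / q.
  congr (_ / _); rewrite -exprM -!exprD; congr (_ ^+ _).
  by rewrite -{1}(subnK nl); lia.
have -> : c * a * q ^+ n = - t ^- 2 * q ^+ p * q ^+ n.+1.
  by rewrite (exprS q n) /a /c /q; field; nonzero.
have -> : - t ^- 2 * q * q ^+ n = - t ^- 2 * q ^+ n.+1 by rewrite -mulrA -exprS.
have -> : q * q ^+ n = q ^+ n.+1 by rewrite exprS.
by rewrite !invfM; ring.
Qed.

(** [aw_connection] is used with the common parameter [c] in front; [aw_swap] moves it there in p_l
    and back in the q-Laguerre polynomials. *)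
Lemma qJacobi_connection l x :
  aw q a0 b c d l x = \sum_(n < l.+1)
    legendre_const l n * (bqj q (l - n) (q ^+ n.+1) (s ^- 2) 1 *
    bqj q (l - n) (q ^+ n.+1) (t ^- 2) (q ^+ p)) * aw q a b c 0 n x.
Proof.
have A0 : a != 0 by rewrite !mulf_neq0 ?invr_neq0 ?expf_neq0.
have A00 : a0 != 0 by rewrite !mulf_neq0 ?invr_neq0 ?expf_neq0.
have cb k : c * b * q ^+ k != 1 by rewrite cbE neg_neq ?inv2_gt0.
have ca0 k : c * a0 * q ^+ k != 1 by rewrite caE neg_neq ?inv2_gt0.
have cd k : c * d * q ^+ k != 1 by rewrite cdE -exprS.
have abE : a * b = q ^+ p.+1 by rewrite /a /b (exprS q p) /q; field; nonzero.
have ab k : a * b * q ^+ k != 1 by rewrite abE -exprD addSn.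
have ab0 k : a0 * b * q ^+ k != 1.
  have -> : a0 * b = q by rewrite /a0 /b /q; field; nonzero.
  by rewrite -exprS.
have caE' : c * a = - t ^- 2 * q ^+ p.+1.
  by rewrite /c /a (exprS q p) /q; field; nonzero.
have ca k : c * a * q ^+ k != 1 by rewrite caE' neg_neq ?inv2_gt0 ?exprn_gt0.
have ad k : a0 * d * q ^+ k != 1.
  have -> : a0 * d = - s ^+ 2 * q by rewrite /a0 /d /q; field; nonzero.
  by rewrite neg_neq ?exprn_gt0.
have z1 k : 0 * q ^+ k != 1 by rewrite mul0r eq_sym oner_eq0.
have a0c k : a0 * c * q ^+ k != 1 by rewrite (mulrC a0).
have ac k : a * c * q ^+ k != 1 by rewrite (mulrC a).
have e1 k : a0 * b * c * d * q ^+ k != 1.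
  have -> : a0 * b * c * d = q ^+ 2 by rewrite -cbadE; ring.
  by rewrite -exprD; exact: (qXS_neq1 k.+1).
have e2 k : a * b * c * 0 * q ^+ k != 1 by rewrite mulr0 z1.
have a0z k : a * 0 * q ^+ k != 1 by rewrite mulr0 z1.
have c0z k : c * 0 * q ^+ k != 1 by rewrite mulr0 z1.
rewrite aw_swap //.
rewrite (aw_connection q c b a0 d a) //.
apply: eq_bigr => -[n nl] _ /=.
rewrite conn_coefE // conn_sumE // (aw_swap q a b c 0) //.
by rewrite -!mulrA.
Qed.

Let eta := h / (s * t).

(** With u = q^k and v = q^(k+p) this is the factor [C u v] of [kernel_commutation]. *)
Lemma lagCE k : lagC q a b c k =
  (1 - q ^+ k) * (1 - q ^+ k * q ^+ p) * (1 + t ^- 2 * (q ^+ k * q ^+ p)) *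
  (1 + s ^- 2 * q ^+ k).
Proof.
case: k => [|k]; first by rewrite /lagC expr0 subrr !mul0r.
rewrite /lagC /a /b /c /= !(exprS q); move: (q ^+ k) (q ^+ p) => W V.
by rewrite /q; field; nonzero.
Qed.

Lemma lagBE k : lagB q a b c k =
  eta * (q ^+ k * (q ^+ p * s ^+ 2 + t ^+ 2 - 1 - q ^+ p) +
         q ^+ p * q ^+ k ^+ 2 * (q + 1)).
Proof.
rewrite /lagB /a /b /c /eta; have := expf_neq0 p q_neq0.
move: (q ^+ k) (q ^+ p) => W V V0.
by rewrite /q; field; nonzero.
Qed.

Let pos1 (x y : R) : 0 < x -> 0 < y -> 0 < 1 + x * y.
Proof. by move=> x0 y0; rewrite addr_gt0 // mulr_gt0. Qed.
Let etaE : eta ^+ 2 = q * s ^- 2 * t ^- 2.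
Proof. by rewrite /eta /q; field; nonzero. Qed.

(** For n + 2 <= l this is [kernel_commutation] times [legendre_const l n.+2], at u = q^m and v =
    q^(m+p); n + 1 = l and n >= l are boundary cases. *)
Lemma kernel_diff l n m :
  legendre_kernel l n m.+1 - legendre_kernel l n m =
    lagC q a b c (m + n.+2) * legendre_kernel l n.+2 m +
    (lagB q a b c (m + n.+1) - lagB q a b c m) * legendre_kernel l n.+1 m -
    lagC q a b c m * legendre_kernel l n.+2 m.-1.
Proof.
set P := q ^+ n.+1; set u := q ^+ m; set v := u * q ^+ p.
have vE : v = q ^+ (m + p) by rewrite exprD.
have u0 : u != 0 by rewrite expf_neq0.
have v0 : v != 0 by rewrite vE expf_neq0.
have P0 : P != 0 by rewrite expf_neq0.
have P1 k : P * q ^+ k != 1 by rewrite -exprD addSn.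
have PP1 k : P ^+ 2 * q ^+ k != 1 by rewrite expr2 -!exprD !addSn.
have r0 : s ^- 2 != 0 by rewrite gt_eqF ?inv2_gt0.
have s0' : t ^- 2 != 0 by rewrite gt_eqF ?inv2_gt0.
have rP k : - s ^- 2 * P * q ^+ k != 1 by rewrite neg_neq ?inv2_gt0 ?exprn_gt0.
have sP k : - t ^- 2 * P * q ^+ k != 1 by rewrite neg_neq ?inv2_gt0 ?exprn_gt0.
have BE : lagB q a b c (m + n.+1) - lagB q a b c m = eta *
    ((v / s ^- 2 + u / t ^- 2 - u - v) * (P - 1) + u * v * (q + 1) * (P ^+ 2 - 1)).
  rewrite !lagBE exprD -/u -/P -/eta -/q /v !invrK.
  by ring.
have CE : lagC q a b c (m + n.+2) =
    (1 - u * P * q) * (1 - v * P * q) * (1 + t ^- 2 * (v * P * q)) *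
    (1 + s ^- 2 * (u * P * q)).
  rewrite lagCE -/q exprD exprSr -/P -/u /v; by ring.
have uS : q ^+ m.+1 = u * q by rewrite exprSr.
have vS : q ^+ (m.+1 + p) = v * q by rewrite vE -exprSr.
have Pq : q ^+ n.+2 = P * q by rewrite exprSr.
have Pqq : q ^+ n.+3 = P * q * q by rewrite -Pq exprSr.
have [nl2|] := leqP n.+2 l; last first.
  rewrite ltnS leq_eqVlt => /orP[/eqP nl|nl].
  - have z j : legendre_kernel l n.+2 j = 0 by rewrite /legendre_kernel nl ltnn.
    rewrite !z !mulr0 add0r subr0 BE.
    have N1 : q != 1 by have := qXS_neq1 0.
    have P2 : 1 - P != 0.
      by rewrite subr_eq0 eq_sym -[P]mulr1 -(expr0 q) P1.
    have PP2 : 1 - P ^+ 2 != 0.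
      by rewrite subr_eq0 eq_sym -[P ^+ 2]mulr1 -(expr0 q) PP1.
    have rP2 : 1 + s ^- 2 * P != 0 by rewrite gt_eqF ?pos1 ?inv2_gt0 ?exprn_gt0.
    have sP2 : 1 + t ^- 2 * P != 0 by rewrite gt_eqF ?pos1 ?inv2_gt0 ?exprn_gt0.
    have T := kernel_commutation_top q P (s ^- 2) (t ^- 2) u v eta q_neq0 N1 P0
      r0 s0' P2 PP2 rP2 sP2.
    have kE := legendre_const_rec l n.
    rewrite nl ltnSn in kE; move: (kE isT) => {}kE.
    rewrite /legendre_kernel nl leqnSn leqnn subSnn subnn.
    rewrite kE subnn expr0 !mulr1 expr1 -/q -/P -/eta.
    rewrite -vE uS vS -/u -/v.
    set k1 := legendre_const _ _.
    have b0 r y : bqj q 0 (q ^+ n.+2) r y = 1.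
      by rewrite /bqj big_ord1 bqj_coef0 qpoch0 mulr1.
    rewrite !b0 !mulr1 -mulrBr mulrAC T; ring.
  - rewrite ltnS in nl.
    have z k j : (l < k)%N -> legendre_kernel l k j = 0.
      by move=> lk; rewrite /legendre_kernel leqNgt lk.
    have z1 j : legendre_kernel l n.+1 j = 0 by apply: z.
    have z2 j : legendre_kernel l n.+2 j = 0 by apply: z; exact: leqW.
    rewrite !z1 !z2 !mulr0 addr0 subr0.
    (* For n = l the big q-Jacobi factors have degree 0, so the kernel does not depend on m; for n >
       l it is zero. *)
    move: nl; rewrite leq_eqVlt => /orP[/eqP ->|nl]; last by rewrite !z // subrr.
    rewrite /legendre_kernel leqnn subnn.
    have b0 r y : bqj q 0 (q ^+ n.+1) r y = 1.
      by rewrite /bqj big_ord1 bqj_coef0 qpoch0 mulr1.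
    by rewrite !b0 subrr.
have nl1 : (n.+1 <= l)%N by exact: ltnW.
have nl0 : (n <= l)%N by exact: ltnW.
set M := (l - n.+2)%N.
have l1 : (l - n.+1 = M.+1)%N by rewrite subnSK.
have l0 : (l - n = M.+2)%N by rewrite -l1 subnSK.
pose dd (y : R) k := (1 + t ^- 2 * y) * (1 + s ^- 2 * y) * (1 - y) ^+ 2 *
  q ^+ k * eta /
  (s ^- 2 * t ^- 2 * y ^+ 2 * (1 - y ^+ 2 * q ^+ k) * (1 - q ^+ k.+1)).
have k0 : legendre_const l n = dd P M.+1 * legendre_const l n.+1.
  by have := legendre_const_rec l n nl1; rewrite l1.
have k1 : legendre_const l n.+1 = dd (P * q) M * legendre_const l n.+2.
  by have := legendre_const_rec l n.+1 nl2; rewrite Pq.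
have T : dd P M.+1 * dd (P * q) M *
    (bqj q M.+2 P (s ^- 2) (u * q) * bqj q M.+2 P (t ^- 2) (v * q) -
     bqj q M.+2 P (s ^- 2) u * bqj q M.+2 P (t ^- 2) v) =
    (1 - u * P * q) * (1 - v * P * q) * (1 + t ^- 2 * (v * P * q)) *
    (1 + s ^- 2 * (u * P * q)) *
    (bqj q M (P * q * q) (s ^- 2) u * bqj q M (P * q * q) (t ^- 2) v) -
    (1 - u) * (1 - v) * (1 + t ^- 2 * v) * (1 + s ^- 2 * u) *
    (bqj q M (P * q * q) (s ^- 2) (u / q) *
     bqj q M (P * q * q) (t ^- 2) (v / q)) +
    eta * ((v / s ^- 2 + u / t ^- 2 - u - v) * (P - 1) +
     u * v * (q + 1) * (P ^+ 2 - 1)) * dd (P * q) M *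
    (bqj q M.+1 (P * q) (s ^- 2) u * bqj q M.+1 (P * q) (t ^- 2) v).
  exact: (kernel_commutation q M P (s ^- 2) (t ^- 2) u v eta q_neq0 P0 u0 v0 r0
    s0' etaE qXS_neq1 P1 PP1 rP sP).
(* At m = 0 the index [m.-1] does not correspond to u / q, but the factor 1 - u is then zero. *)
have last_term : lagC q a b c m * legendre_kernel l n.+2 m.-1 =
  (1 - u) * (1 - v) * (1 + t ^- 2 * v) * (1 + s ^- 2 * u) * (legendre_const l n.+2 *
  (bqj q M (P * q * q) (s ^- 2) (u / q) * bqj q M (P * q * q) (t ^- 2) (v / q))).
  rewrite lagCE /legendre_kernel nl2 -/q -/M Pqq -/u -/v.
  have [m0|mp] := posnP m.
    have -> : u = 1 by rewrite /u m0 expr0.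
    by rewrite subrr !mul0r.
  have uE : q ^+ m.-1 = u / q by rewrite /u -{2}(prednK mp) exprSr mulfK.
  have vE' : q ^+ (m.-1 + p) = v / q by rewrite exprD uE /v mulrAC.
  by rewrite uE vE'.
rewrite last_term CE BE /legendre_kernel nl0 nl1 nl2 l0 l1 -/M.
rewrite -/q -vE uS vS Pq Pqq -/u -/v -/P -/(legendre_const l n) -/(legendre_const l n.+1)
  -/(legendre_const l n.+2) k0 k1.
move/(congr1 ( *%R (legendre_const l n.+2))): T => T.
transitivity (legendre_const l n.+2 * (dd P M.+1 * dd (P * q) M *
    (bqj q M.+2 P (s ^- 2) (u * q) * bqj q M.+2 P (t ^- 2) (v * q) -
     bqj q M.+2 P (s ^- 2) u * bqj q M.+2 P (t ^- 2) v))); first by ring.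
by rewrite T; ring.
Qed.

(** By [lag_normS] every coefficient [lagC] trades one norm for the next, so this is [kernel_diff]
    times [lag_norm (m + n.+1)], in the form that [functional_matrix] needs. *)
Lemma kernel_rec l n m :
  lag_norm (m.+1 + n) * legendre_kernel l n m.+1 =
    lag_norm (m + n.+2) * legendre_kernel l n.+2 m +
    (lagB q a b c (m + n.+1) - lagB q a b c m) *
      (lag_norm (m + n.+1) * legendre_kernel l n.+1 m) +
    lagC q a b c (m + n.+1) * (lag_norm (m + n) * legendre_kernel l n m) -
    lagC q a b c m * (lag_norm (m.-1 + n.+2) * legendre_kernel l n.+2 m.-1).
Proof.
have lagC0 : lagC q a b c 0 = 0 by rewrite lagCE expr0 subrr !mul0r.
have H1 : lag_norm (m.+1 + n) = lag_norm (m + n.+1) by rewrite addSnnS.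
have H2 : lag_norm (m + n.+2) = lagC q a b c (m + n.+2) * lag_norm (m + n.+1).
  by rewrite mulrC [(m + n.+2)%N]addnS; exact: lag_normS.
have H3 : lag_norm (m + n.+1) = lagC q a b c (m + n.+1) * lag_norm (m + n).
  by rewrite mulrC addnS; exact: lag_normS.
have H4 : lagC q a b c m * lag_norm (m.-1 + n.+2) =
    lagC q a b c m * lag_norm (m + n.+1).
  have [->|mp] := posnP m; first by rewrite lagC0 !mul0r.
  by rewrite -addSnnS prednK.
rewrite H1 H2 !(mulrA (lagC _ _ _ _ m)) H4 !(mulrA (lagC _ _ _ _ (m + n.+1))) -H3.
rewrite -[legendre_kernel l n m.+1](subrK (legendre_kernel l n m)) kernel_diff.
ring.
Qed.

Lemma qLaguerre_rec k x : let L := fun k => aw q a b c 0 k x in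
  x *+ 2 * L k = L k.+1 + lagB q a b c k * L k + lagC q a b c k * L k.-1.
Proof.
apply: laguerre_rec => //; first by rewrite !mulf_neq0 ?invr_neq0 ?expf_neq0.
- have -> : a * b = q ^+ p.+1 by rewrite /a /b (exprS q p) /q; field; nonzero.
  by move=> j; rewrite -exprD addSn.
- have -> : a * c = - t ^- 2 * q ^+ p.+1.
    by rewrite /c /a (exprS q p) /q; field; nonzero.
  by move=> j; rewrite neg_neq ?inv2_gt0 ?exprn_gt0.
Qed.
End Kernel.

Arguments legendre_const {R}.
Arguments legendre_kernel {R}.
Arguments lag_norm {R}.

(** * Matrix entries of a linear functional in a basis with a three-term recurrence *)

Section RecurrenceFunctional.
Variables (R : comNzRingType) (L : nat -> R -> R) (B C : nat -> R).
Hypothesis L0 : forall x, L 0 x = 1.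
Hypothesis Lrec : forall n x,
  x *+ 2 * L n x = L n.+1 x + B n * L n x + C n * L n.-1 x.

(** [J] is assumed linear on this span only, since an integral is linear only on integrable
    functions. *)
Inductive lspan : (R -> R) -> Prop :=
| lspan_gen i : lspan (L i)
| lspan_lin k f g : lspan f -> lspan g -> lspan (fun x => k * f x + g x).

Lemma lspan_lin3 k1 k2 f g h : lspan f -> lspan g -> lspan h ->
  lspan (fun x => f x + k1 * g x + k2 * h x).
Proof.
move=> f1 g1 h1.
have -> : (fun x => f x + k1 * g x + k2 * h x) =
    (fun x => k2 * h x + (k1 * g x + f x)) by apply/funext => x; ring.
by do 2 apply: lspan_lin => //.
Qed.

Lemma lspan_mulX f : lspan f -> lspan (fun x => x *+ 2 * f x).
Proof.
elim=> [i|k {}f g _ IHf _ IHg].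
  have -> : (fun x => x *+ 2 * L i x) =
      (fun x => L i.+1 x + B i * L i x + C i * L i.-1 x) by exact/funext/Lrec.
  by apply: lspan_lin3; exact: lspan_gen.
have -> : (fun x => x *+ 2 * (k * f x + g x)) =
    (fun x => k * (x *+ 2 * f x) + x *+ 2 * g x) by apply/funext => x; ring.
exact: lspan_lin.
Qed.

(** Strong induction on n: the recurrence writes f L_(n+1) through 2x f L_n, f L_n and f L_(n-1). *)
Lemma lspan_mulL n f : lspan f -> lspan (fun x => f x * L n x).
Proof.
move=> f1.
elim/ltn_ind: n => -[_|n IH].
  by have -> : (fun x => f x * L 0 x) = f by apply/funext => x; rewrite L0 mulr1.
have -> : (fun x => f x * L n.+1 x) = (fun x => x *+ 2 * (f x * L n x) +
    - B n * (f x * L n x) + - C n * (f x * L n.-1 x)).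
  apply/funext => x; have -> : L n.+1 x = x *+ 2 * L n x - B n * L n x - C n * L n.-1 x.
    by rewrite Lrec; ring.
  by ring.
by apply: lspan_lin3; [apply: lspan_mulX|..]; apply: IH => //; lia.
Qed.

Lemma lspan_sum n (c : nat -> R) :
  lspan (fun x => \sum_(i < n.+1) c i * L i x).
Proof.
elim: n => [|n IH].
  (* [lspan_lin] always adds a member of the span, hence the coefficient [c 0 - 1]. *)
  have -> : (fun x => \sum_(i < 1) c i * L i x) = (fun x => (c 0 - 1) * L 0 x + L 0 x).
    by apply/funext => x; rewrite big_ord1; ring.
  by apply: lspan_lin; exact: lspan_gen.
have -> : (fun x => \sum_(i < n.+2) c i * L i x) =
    (fun x => c n.+1 * L n.+1 x + \sum_(i < n.+1) c i * L i x).
  by apply/funext => x; rewrite big_ord_recr addrC.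
exact/lspan_lin/IH/lspan_gen.
Qed.

Variable J : (R -> R) -> R.
Hypothesis Jlin : forall k f g, lspan f -> lspan g ->
  J (fun x => k * f x + g x) = k * J f + J g.

Lemma functional_lin3 k1 k2 f g h : lspan f -> lspan g -> lspan h ->
  J (fun x => f x + k1 * g x + k2 * h x) = J f + k1 * J g + k2 * J h.
Proof.
move=> f1 g1 h1.
have -> : (fun x => f x + k1 * g x + k2 * h x) =
    (fun x => k2 * h x + (k1 * g x + f x)) by apply/funext => x; ring.
by rewrite !Jlin //; [ring | exact: lspan_lin].
Qed.

Lemma functional_sum k n (c : nat -> R) :
  J (fun x => (\sum_(i < n.+1) c i * L i x) * L k x) =
  \sum_(i < n.+1) c i * J (fun x => L i x * L k x).
Proof.
have LL i : lspan (fun x => L i x * L k x) by apply/lspan_mulL/lspan_gen.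
elim: n => [|n IH].
  rewrite big_ord1.
  have -> : (fun x => (\sum_(i < 1) c i * L i x) * L k x) =
      (fun x => (c 0 - 1) * (L 0 x * L k x) + L 0 x * L k x).
    by apply/funext => x; rewrite big_ord1 /=; ring.
  by rewrite Jlin //=; ring.
have -> : (fun x => (\sum_(i < n.+2) c i * L i x) * L k x) =
    (fun x => c n.+1 * (L n.+1 x * L k x) +
              (\sum_(i < n.+1) c i * L i x) * L k x).
  by apply/funext => x; rewrite big_ord_recr /= mulrDl addrC mulrA.
rewrite Jlin //; last exact/lspan_mulL/lspan_sum.
by rewrite IH [RHS]big_ord_recr addrC.
Qed.

(** Applying the recurrence to either factor of J(f 2x L_m L_k) gives [Irec]. In terms of the offset
    n = k - m it yields row m + 1 from rows m and m - 1. *)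
Lemma functional_matrix f (K : nat -> nat -> R) :
  lspan f -> C 0 = 0 ->
  (forall n, J (fun x => f x * L n x) = K n 0) ->
  (forall n m, K n m.+1 = K n.+2 m + (B (m + n.+1) - B m) * K n.+1 m +
     C (m + n.+1) * K n m - C m * K n.+2 m.-1) ->
  forall m n, J (fun x => f x * L m x * L (m + n) x) = K n m.
Proof.
move=> f1 C0 K0 Krec.
pose I m k := J (fun x => f x * L m x * L k x).
have Irec m k : I m.+1 k + B m * I m k + C m * I m.-1 k =
    I m k.+1 + B k * I m k + C k * I m k.-1.
  rewrite /I -!functional_lin3; try by do 2 apply: lspan_mulL.
  congr (J _); apply/funext => x.
  have := Lrec m x; have := Lrec k x => Hk Hm.
  transitivity (f x * L k x * (x *+ 2 * L m x)); first by rewrite Hm; ring.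
  by transitivity (f x * L m x * (x *+ 2 * L k x)); [ring | rewrite Hk; ring].
elim/ltn_ind => -[_ n|m IH n].
  rewrite add0n -K0; congr (J _); apply/funext => x.
  by rewrite L0 mulr1.
(* With k = m + n + 1 the entry in row m + 1 has offset n, and the others have offsets n, n + 1 and
   n + 2. *)
have H := Irec m (m + n.+1)%N; rewrite /I in H.
have e1 : ((m + n.+1).+1 = m + n.+2)%N by lia.
have e2 : ((m + n.+1).-1 = m + n)%N by lia.
have e3 : (m.+1 + n = m + n.+1)%N by lia.
rewrite e1 e2 !IH // in H.
rewrite e3 Krec.
have H' : C m * J (fun x => f x * L m.-1 x * L (m + n.+1) x) = C m * K n.+2 m.-1.
  have [->|mp] := posnP m; first by rewrite C0 !mul0r.
  have -> : (m + n.+1 = m.-1 + n.+2)%N by lia.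
  by rewrite IH //; lia.
rewrite H' in H.
move: (J _) H => z H.
have -> : z = (z + B m * K n.+1 m + C m * K n.+2 m.-1) - B m * K n.+1 m - C m * K n.+2 m.-1.
  by ring.
by rewrite H; ring.
Qed.
End RecurrenceFunctional.

Arguments lspan {R}.

(** * From complex series and real powers to the rational forms *)

(** The root w = x + sqrt(x^2 - 1) enters only through the pairs (aw, a/w; q)_k, which depend on w +
    1/w = 2x alone. *)
Lemma askey_wilson_rmorph {R : realType} (f : {rmorphism R -> R[i]%C}) (q : R) n
    (x a b c d : R) : q != 0 ->
  askey_wilson (f q) n (f x) (f a) (f b) (f c) (f d) = f (aw q a b c d n x).
Proof.
move=> q0.
have fq0 : f q != 0 by rewrite fmorph_eq0.
have pochR e k : qpoch (f e) (f q) k = f (qpoch e q k).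
  rewrite /qpoch rmorph_prod /=; apply: eq_bigr => i _.
  by rewrite rmorphB rmorphM rmorphXn rmorph1.
have [w0 wE] := joukowski_root (f x).
rewrite /askey_wilson qhyp_terminating // /aw /aw_sum.
rewrite !rmorphM.
rewrite rmorph_sum.
rewrite fmorphV rmorphXn /=; congr (_ * _ * _).
  by rewrite /qpochs !big_cons big_nil mulr1 -!pochR !rmorphM mulrA.
apply: eq_bigr => k _; rewrite /aw_coef /qhyp_term.
rewrite /qpochs !big_cons !big_nil !mulr1 (qpoch_pair (f q) (f a) k w0) wE.
rewrite !(rmorphM, fmorphV) -!pochR !(rmorphM, fmorphV, rmorphXn) /=.
have -> : f q ^ (n%:Z - 1) = f q ^+ n / f q by rewrite expfzDr // expr1z.
have -> : f (aw_base q a x k) =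
    \prod_(i < k) (1 - f a * f q ^+ i * (f x *+ 2) + f a ^+ 2 * f q ^+ i ^+ 2).
  rewrite rmorph_prod; apply: eq_bigr => i _.
  by rewrite rmorphD rmorphB rmorph1 !rmorphM !rmorphXn rmorphMn.
rewrite !invfM !mulrA.
by ring.
Qed.

Lemma askey_wilson_real_aw {R : realType} (q : R) n (x a b c d : R) : q != 0 ->
  askey_wilson_real q n x a b c d = aw q a b c d n x.
Proof.
move=> q0; apply: (fmorph_inj (real_complex R)).
apply: etrans (askey_wilson_realE n x a b c d q0) _.
exact: (askey_wilson_rmorph (real_complex R)).
Qed.

Lemma powR_sqr_half {R : realType} (h : R) : 0 < h -> (h ^+ 2) `^ 2^-1 = h.
Proof.
by move=> h0; rewrite -powR_mulrn ?ltW // -powRrM divff // powRr1 // ltW.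
Qed.

Lemma powR_sqr_addn {R : realType} (h : R) n : 0 < h ->
  (h ^+ 2) `^ (2^-1 + n%:R) = h ^+ 2 ^+ n * h.
Proof.
move=> h0; have q0 : 0 < h ^+ 2 by rewrite exprn_gt0.
rewrite powRD ?(gt_eqF q0) ?implybT // powR_mulrn ?ltW // mulrC.
by rewrite powR_sqr_half.
Qed.

Lemma big_qJacobiE {R : realType} (q tau : R) n N m : 0 < q ->
  big_qJacobi q n%:R n%:R N (- q ^+ m) (q `^ (2 * tau)) 1 =
  bqj q N (q ^+ n.+1) ((q `^ tau) ^- 2) (q ^+ m).
Proof.
move=> q0; have qn0 : q != 0 by rewrite gt_eqF.
rewrite /big_qJacobi qhyp_terminating // /bqj; apply: eq_bigr => k _.
rewrite /qhyp_term /bqj_coef /qpochs !big_cons !big_nil !mulr1.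
have e1 : q `^ (N%:R + n%:R + n%:R + 1) = q ^+ n.+1 ^+ 2 * q ^+ N / q.
  have -> : N%:R + n%:R + n%:R + 1 = (N + n + n + 1)%:R :> R by rewrite !natrD.
  rewrite powR_mulrn ?ltW // -exprM -exprD.
  have -> : (n.+1 * 2 + N = (N + n + n + 1).+1)%N by lia.
  by rewrite exprSr mulfK.
have e2 : q `^ (n%:R + 1) = q ^+ n.+1 by rewrite natr1 powR_mulrn ?ltW.
have e3 : q `^ (2 * tau) = (q `^ tau) ^+ 2.
  by rewrite (mulrC 2) powRrM powR_mulrn ?powR_ge0.
have e4 : q `^ (1 + n%:R) = q ^+ n.+1 by rewrite addrC.
rewrite e1 e2 e3 e4.
have -> : q ^+ n.+1 * - q ^+ m / (q `^ tau) ^+ 2 =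
  - (q `^ tau) ^- 2 * q ^+ m * q ^+ n.+1 by ring.
have -> : - q ^+ n.+1 / (q `^ tau) ^+ 2 = - (q `^ tau) ^- 2 * q ^+ n.+1 by ring.
by rewrite !invfM; ring.
Qed.

Lemma D_constE {R : realType} (h tau sigma : R) n l : 0 < h -> (n <= l)%N ->
  D_const (h ^+ 2) n l tau sigma =
  legendre_const h ((h ^+ 2) `^ tau) ((h ^+ 2) `^ sigma) l n.
Proof.
move=> h0 nl; have q0 : 0 < h ^+ 2 by rewrite exprn_gt0.
rewrite /D_const /legendre_const; set q := h ^+ 2 in q0 *.
have e3 x : q `^ (2 * x - l%:R) = (q `^ x) ^+ 2 / q ^+ l.
  rewrite powRD ?(gt_eqF q0) ?implybT // powRN powR_mulrn ?ltW //.
  by rewrite (mulrC 2) powRrM powR_mulrn ?powR_ge0.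
rewrite !e3 /qpochs !big_cons big_nil mulr1 !addn1; congr (_ * _ * _ * _).
set N := (l - n)%N; have -> : l%:R - n%:R = N%:R :> R by rewrite natrB.
(* The three summands give the powers of h, s and t; the factor 1/2 is absorbed by h = q^(1/2). *)
have -> : 2^-1 * N%:R * (N%:R - 2 * sigma - 2 * tau) =
    2^-1 * (N * N)%:R + - (tau * N%:R) + - (sigma * N%:R) :> R.
  by rewrite natrM; field.
rewrite !powRD ?(gt_eqF q0) ?implybT // !powRN !powRrM.
rewrite powR_sqr_half // !powR_mulrn ?powR_ge0 ?ltW //.
by rewrite exprMn invfM mulrA.
Qed.

(** * Positivity of the constants and integrability *)

Lemma qpoch_gt0 {K : numFieldType} (a q : K) k :
  (forall i, 0 < 1 - a * q ^+ i) -> 0 < qpoch a q k.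
Proof. by move=> H; apply: prodr_gt0 => i _; apply: H. Qed.

Lemma legendre_const_gt0 {R : realFieldType} (h s t : R) l n :
  0 < h -> h < 1 -> 0 < s -> 0 < t -> 0 < legendre_const h s t l n.
Proof.
move=> h0 h1 s0 t0; rewrite /legendre_const.
have q0 : 0 < h ^+ 2 by rewrite exprn_gt0.
have q1 : h ^+ 2 < 1 by rewrite expr_lt1 // ltW.
set q := h ^+ 2 in q0 q1 *.
have P k j : 0 < qpoch (q ^+ k.+1) q j.
  apply: qpoch_gt0 => i; rewrite -exprD addSn subr_gt0.
  by rewrite exprn_ilt1 // ltW.
have M x k j : 0 < x -> 0 < qpoch (- (x ^+ 2 / q ^+ k)) q j.
  move=> x0; apply: qpoch_gt0 => i; rewrite mulNr opprK ltr_wpDr //.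
  by rewrite !mulr_ge0 ?invr_ge0 ?exprn_ge0 ?ltW.
by rewrite !mulr_gt0 ?invr_gt0 ?exprn_gt0 ?mulr_gt0 ?M ?P // -[q]expr1 P.
Qed.

Lemma lag_norm_gt0 {R : realFieldType} (h s t : R) p k :
  0 < h -> h < 1 -> 0 < s -> 0 < t -> 0 < lag_norm h s t p k.
Proof.
move=> h0 h1 s0 t0; rewrite /lag_norm.
have q0 : 0 < h ^+ 2 by rewrite exprn_gt0.
have q1 : h ^+ 2 < 1 by rewrite expr_lt1 // ltW.
set q := h ^+ 2 in q0 q1 *.
have P k' j : 0 < qpoch (q ^+ k'.+1) q j.
  apply: qpoch_gt0 => i; rewrite -exprD addSn subr_gt0.
  by rewrite exprn_ilt1 // ltW.
have M x k' j : 0 < x -> 0 < qpoch (- q ^+ k' * x ^- 2) q j.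
  move=> x0; apply: qpoch_gt0 => i; rewrite !mulNr opprK ltr_wpDr //.
  by rewrite !mulr_ge0 ?invr_ge0 ?exprn_ge0 ?ltW.
rewrite /qpochs !big_cons big_nil mulr1.
have := P 0%N k; have := M s 1%N k s0; rewrite expr1 => H1 H2.
by rewrite !mulr_gt0 // ?M.
Qed.

Lemma lspan_integrable {R : realType} (mu : probability (measurableTypeR R) R)
    (L : nat -> R -> R) f :
  (forall i, mu.-integrable setT (EFin \o L i)) -> lspan L f ->
  mu.-integrable setT (EFin \o f).
Proof.
move=> Li; elim=> // k {}f g _ If _ Ig.
have -> : EFin \o (fun x => k * f x + g x) =
    ((fun x => k%:E * (EFin \o f) x) \+ (EFin \o g))%E by [].
by apply: integrableD => //; exact: integrableZl.
Qed.

(** * The integral formula, with integration against [mu] as the functional *)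

Theorem corollary5p1 (R : realType) (q : R) (hq : 0 < q < 1)
    (l n : nat) (hnl : (n <= l)%N) (m p : nat) (sigma tau : R)
    (mu : probability (measurableTypeR R) R)
    (hmu : qLaguerre_measure q p (q `^ tau) (q `^ sigma) mu) :
  ((big_qJacobi q n%:R n%:R (l - n) (- q ^+ m) (q `^ (2 * tau)) 1 *
    big_qJacobi q n%:R n%:R (l - n) (- q ^+ (m + p)) (q `^ (2 * sigma)) 1)%:E =
   ((C_const q n l m p tau sigma)^-1)%:E *
   \int[mu]_x (qJacobi q 0 0 l x (q `^ tau) (q `^ sigma) *
               qLaguerre q p%:R m x (q `^ tau) (q `^ sigma) *
               qLaguerre q p%:R (m + n) x (q `^ tau) (q `^ sigma))%:E)%E.
Proof.
have /andP[q0 q1] := hq.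
have [h [h0 h1 qE]] : exists h, [/\ 0 < h, h < 1 & q = h ^+ 2].
  exists (Num.sqrt q); split; rewrite ?sqrtr_gt0 ?sqr_sqrtr ?ltW //.
  by rewrite -[1]sqrtr1 ltr_sqrt.
rewrite !big_qJacobiE // {hq}.
have hE : q `^ 2^-1 = h by rewrite qE powR_sqr_half.
have hpE : q `^ (2^-1 + p%:R) = q ^+ p * h by rewrite qE powR_sqr_addn.
have DE : D_const q n l tau sigma = legendre_const h (q `^ tau) (q `^ sigma) l n.
  by rewrite qE D_constE.
have NE : qpochs [:: q; q ^+ (1 + p); - q `^ (1 - 2 * tau);
           - q `^ (1 + p%:R - 2 * sigma)] q (m + n) =
          lag_norm h (q `^ tau) (q `^ sigma) p (m + n).
  have e2 x : q `^ (2 * x) = (q `^ x) ^+ 2.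
    by rewrite (mulrC 2) powRrM powR_mulrn ?powR_ge0.
  have Q x y : q `^ (x - 2 * y) = q `^ x * (q `^ y) ^- 2.
    by rewrite powRD ?(gt_eqF q0) ?implybT // powRN e2.
  rewrite /lag_norm -qE !Q nat1r powR_mulrn ?ltW // powRr1 ?ltW //.
  by rewrite !mulNr add1n.
rewrite /C_const DE NE {DE NE}.
have s0 : 0 < q `^ tau by rewrite powR_gt0.
have t0 : 0 < q `^ sigma by rewrite powR_gt0.
move: (q `^ tau) (q `^ sigma) s0 t0 hmu => s t s0 t0 hmu.
pose L k x := aw q (q ^+ p * h * s / t) (h * t / s) (- h / (s * t)) 0 k x.
have LE k x : qLaguerre q p%:R k x s t = L k x.
  by rewrite /qLaguerre askey_wilson_real_aw ?gt_eqF // hpE hE.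
pose f x := aw q (h * s / t) (h * t / s) (- h / (s * t)) (- (s * t) * h) l x.
have fE x : qJacobi q 0 0 l x s t = f x.
  by rewrite /qJacobi askey_wilson_real_aw ?gt_eqF // addr0 hE.
under eq_integral do rewrite fE !LE.
have L0 x : L 0 x = 1.
  by rewrite /L aw_d0 big_ord1 /aw_base big_ord0 !qpoch0 !expr0 !(invr1, mulr1).
have Lrec k x : x *+ 2 * L k x =
    L k.+1 x + lagB q (q ^+ p * h * s / t) (h * t / s) (- h / (s * t)) k * L k x +
    lagC q (q ^+ p * h * s / t) (h * t / s) (- h / (s * t)) k * L k.-1 x.
  rewrite /L qE; exact: qLaguerre_rec.
have LL i j : mu.-integrable setT (fun x => (L i x * L j x)%:E) /\
    (\int[mu]_x (L i x * L j x)%:E = ((i == j)%:R * lag_norm h s t p j)%:E)%E.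
  have := hmu i j; rewrite /lag_norm -qE /=.
  by under [X in _.-integrable _ X]funext do rewrite !LE;
     under eq_integral do rewrite !LE.
(* Integrability of a single L_i is the case j = 0 of the hypothesis, since L_0 = 1. *)
have Lint i : mu.-integrable setT (EFin \o L i).
  have [H _] := LL i 0%N.
  by apply: eq_integrable H => // x _ /=; rewrite L0 mulr1.
have intL := lspan_integrable mu L _ Lint.
pose J g := Rintegral mu setT g.
have Jlin k g1 g2 : lspan L g1 -> lspan L g2 ->
    J (fun x => k * g1 x + g2 x) = k * J g1 + J g2.
  move=> /intL i1 /intL i2; rewrite /J RintegralD ?RintegralZl //.
  exact: (integrableZl _ _ i1).
have Jorth i j : J (fun x => L i x * L j x) = (i == j)%:R * lag_norm h s t p j.
  by rewrite /J /Rintegral (LL i j).2.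
pose cf i := legendre_const h s t l i *
    (bqj q (l - i) (q ^+ i.+1) (s ^- 2) 1 *
     bqj q (l - i) (q ^+ i.+1) (t ^- 2) (q ^+ p)).
have fsum : f = fun x => \sum_(i < l.+1) cf i * L i x.
  apply/funext => x; rewrite /f qE (qJacobi_connection R h s t p) //.
  by rewrite /cf /L qE.
have fspan : lspan L f by rewrite fsum; exact: lspan_sum.
(* The kernel is divided by the squared norm of l_(m+n); multiplying it back gives the integral
   itself. *)
pose K n' m' := lag_norm h s t p (m' + n') * legendre_kernel h s t p l n' m'.
have KE : J (fun x => f x * L m x * L (m + n)%N x) = K n m.
  apply: (functional_matrix R L _ _ L0 Lrec J Jlin f K fspan).
  - by rewrite /lagC expr0 subrr !mul0r.
  (* Initial values: orthogonality picks the connection coefficient of index k, or zero when k >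
     l. *)
  - move=> k; rewrite fsum.
    rewrite (functional_sum R L _ _ L0 Lrec J Jlin k l cf).
    rewrite /K add0n /legendre_kernel -qE.
    under eq_bigr do rewrite Jorth.
    have [kl|lk] := leqP k l; last first.
      rewrite mulr0 big1 // => -[i il] _ /=.
      by rewrite (ltn_eqF (leq_trans il lk)) mul0r mulr0.
    rewrite (bigD1 (Ordinal (kl : (k < l.+1)%N))) //= eqxx mul1r big1 ?addr0.
      by rewrite expr0 add0n mulrC.
    move=> i; rewrite -val_eqE /= => /negPf ->.
    by rewrite mul0r mulr0.
  - by move=> n' m'; rewrite /K qE; exact: kernel_rec.
have -> : (\int[mu]_x (f x * L m x * L (m + n)%N x)%:E)%E = (K n m)%:E.
  rewrite -KE /J /Rintegral fineK //; apply: integrable_fin_num => //.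
  by apply: intL; do 2 apply: (lspan_mulL _ _ _ _ L0 Lrec).
rewrite -EFinM /K /legendre_kernel hnl -qE; congr EFin.
(* C is the product of [legendre_const] and [lag_norm], both positive, so its inverse cancels
   them. *)
rewrite (mulrCA (lag_norm _ _ _ _ _)) mulrA mulrA mulVf ?mul1r //.
by rewrite mulf_neq0 // gt_eqF ?legendre_const_gt0 ?lag_norm_gt0.
Qed.
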